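(* Let $\mathcal{X}$ and $\Theta$ (with metric $d_\Theta$) be compact metric spaces, let $\mu:\mathcal{X}\times\Theta\to\mathbb{R}$ be continuous, and let $f_\theta:\mathcal{X}\to\mathbb{R}^p$, $\theta\in\Theta$, be functions such that for each $\theta$ the image $f_\theta(\mathcal{X})$ spans $\mathbb{R}^p$ and $(x,\theta)\mapsto f_\theta(x)$ is continuous on $\mathcal{X}\times\Theta$. Assume saturated identifiability: whenever $z_1,\ldots,z_p\in\mathcal{X}$ are pairwise distinct and $\theta,\theta'\in\Theta$ satisfy $\mu(z_j,\theta)=\mu(z_j,\theta')$ for $1\le j\le p$, then $\theta=\theta'$. Consider random variables $X_i$ ($\mathcal{X}$-valued) and $Y_i$ (real), $i\in\mathbb{N}$, on a probability space $(\Omega,\mathcal{F},\mathbb{P}_{\bar\theta})$, with $\bar\theta\in\Theta$ the true parameter, generated by the adaptive Wynn algorithm: $X_1,\ldots,X_{n_{\rm st}}$ are fixed points $x_1,\ldots,x_{n_{\rm st}}$ such that $M(\xi_{n_{\rm st}},\theta)$ is positive definite for all $\theta\in\Theta$; for $n\ge n_{\rm st}$, $\hat\theta_n=\hat\theta_n(X_1,Y_1,\ldots,X_n,Y_n)\in\Theta$ is an arbitrary (adaptive) estimator, and $$X_{n+1}\in\arg\max_{x\in\mathcal{X}} f_{\hat\theta_n}^{\mathsf T}(x)\,M^{-1}(\xi_n,\hat\theta_n)\,f_{\hat\theta_n}(x),\qquad \xi_n=\tfrac1n\sum_{i=1}^n\delta_{X_i}.$$ Assume further: (A1) there is a nondecreasing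 sequence of sub-$\sigma$-fields $\mathcal{F}_0\subseteq\mathcal{F}_1\subseteq\cdots\subseteq\mathcal{F}$ such that $X_i$ is $\mathcal{F}_{i-1}$-measurable and $Y_i$ is $\mathcal{F}_i$-measurable for each $i\in\mathbb{N}$; (A2) $Y_i=\mu(X_i,\bar\theta)+e_i$ with real square-integrable errors $e_i$ satisfying $\mathrm{E}(e_i\mid\mathcal{F}_{i-1})=0$ a.s. for all $i$ and $\sup_{i\in\mathbb{N}}\mathrm{E}(e_i^2\mid\mathcal{F}_{i-1})<\infty$ a.s. Then, irrespective of the adaptive estimators $\hat\theta_n$ employed in the algorithm, the adaptive least squares estimators $$\hat\theta_n^{(\mathrm{LS})}\in\arg\min_{\theta\in\Theta}\sum_{i=1}^n\bigl(Y_i-\mu(X_i,\theta)\bigr)^2,\qquad n\ge n_{\rm st},$$ are strongly consistent: $\hat\theta_n^{(\mathrm{LS})}\to\bar\theta$ almost surely as $n\to\infty$.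
   Context: A design is a finitely supported probability measure on $\mathcal{X}$; $\delta_x$ denotes the point mass at $x$. The information matrix of a design $\xi$ at $\theta$ is $M(\xi,\theta)=\sum_{x\in\mathrm{supp}(\xi)}\xi(x)f_\theta(x)f_\theta^{\mathsf T}(x)$. The estimators $\hat\theta_n$ and $\hat\theta_n^{(\mathrm{LS})}$ are $\Theta$-valued functions of the data available at stage $n$ (measurable random variables). *)

(* Defs.v *)
From HB Require Import structures.
From mathcomp Require Import all_boot all_order all_algebra.
From mathcomp Require Import all_classical all_reals all_analysis.
Set Implicit Arguments. Unset Strict Implicit. Unset Printing Implicit Defensive.
Import Order.TTheory GRing.Theory Num.Theory.
Import numFieldNormedType.Exports.
Local Open Scope classical_set_scope.
Local Open Scope ring_scope.

(* Measurability of a map into a topological space with respect to a family of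
   subsets G of Omega (a sub-sigma-field): preimages of open sets (hence of all
   Borel sets, when G is a sigma-algebra) lie in G. *)
Definition borel_meas_wrt (Omega : Type) (T : topologicalType)
  (G : set (set Omega)) (Z : Omega -> T) : Prop :=
  forall U : set T, open U -> G (Z @^-1` U).

Definition sub_sigma_field d (Omega : measurableType d) (G : set (set Omega)) :=
  sigma_algebra [set: Omega] G /\ G `<=` measurable.

Definition is_cond_exp d (Omega : measurableType d) (R : realType)
  (P : probability Omega R) (G : set (set Omega)) (Z g : Omega -> R) : Prop :=
  [/\ borel_meas_wrt G g,
      P.-integrable [set: Omega] (fun w => (g w)%:E) &
      forall A, G A ->
        (\int[P]_(w in A) (g w)%:E = \int[P]_(w in A) (Z w)%:E)%E].

(* The information matrix M(xi_n, theta) of the empirical design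
   xi_n = (1/n) sum_{i=1}^n delta_{x_i}, i.e.
   sum_{x in supp xi_n} xi_n(x) f_theta(x) f_theta(x)^T
   = (1/n) sum_{i=1}^n f_theta(x_i) f_theta(x_i)^T. *)
Definition info_emp (R : realType) (Xs Th : Type) (p : nat)
  (f : Th -> Xs -> 'cV[R]_p) (x : nat -> Xs) (n : nat) (th : Th) : 'M[R]_p :=
  (n%:R)^-1 *: \sum_(1 <= i < n.+1) (f th (x i) *m (f th (x i))^T).

Definition posdef (R : realType) (p : nat) (A : 'M[R]_p) : Prop :=
  forall v : 'cV[R]_p, v != 0 -> 0 < (v^T *m A *m v) 0 0.

Definition spans (R : realType) (Xs : Type) (p : nat) (g : Xs -> 'cV[R]_p) :=
  forall v : 'cV[R]_p, exists (k : nat) (z : 'I_k -> Xs) (c : 'I_k -> R),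
    v = \sum_(j < k) c j *: g (z j).

(* Main.v *)
Require Import Defs.
From HB Require Import structures.
From mathcomp Require Import all_boot all_order all_algebra.
From mathcomp Require Import all_classical all_reals all_analysis.
From mathcomp Require Import finmap measurable_realfun zify ring lra.
Import Order.TTheory GRing.Theory Num.Theory.
Import numFieldNormedType.Exports.
Local Open Scope classical_set_scope.
Local Open Scope ring_scope.

(** Let [A] be the inverse information matrix, [y] the next design point and
[D = f(y)^T A f(y)], which is at least the average [p] of [f^T A f] over the
design.  By maximality, [f(y)^T A f(z)] is at most [D] in absolute value for all
[z]; testing this on the initial design, which spans uniformly in the parameter,
shows that it is close to [D] for [z] near [y].  As its mean square under the
design is [D], a small ball around [y] has mass at most about [1/D <= 1/p].
Hence all small balls eventually carry mass less than [1/(p - 1)], and [p - 1]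
of them cannot carry almost all observations, whatever the estimators are.  By
saturated identifiability and compactness, the points where [mu _ th] and
[mu _ thbar] nearly agree lie in [p - 1] small balls, so the sum of
[(mu(X_i, th) - mu(X_i, thbar))^2] grows linearly, uniformly in [th] away from
[thbar].  A strong law for martingale differences, made uniform in [th] by
finite nets, shows that the least squares estimator keeps this sum sublinear. *)

Set Implicit Arguments.
Unset Strict Implicit.

(** * Information matrices and the mass of a design near its next point *)

Definition dot (R : realType) (p : nat) (u v : 'cV[R]_p) : R := (u^T *m v) 0 0.

Section design.
Context (R : realType) (p : nat).
Implicit Types (u v w : 'cV[R]_p).

Lemma dotE u v : dot u v = \sum_k u k 0 * v k 0.
Proof. by rewrite /dot mxE; apply: eq_bigr => k _; rewrite mxE. Qed.

Lemma dotBr u v w : dot u (v - w) = dot u v - dot u w.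
Proof. by rewrite /dot mulmxBr !mxE. Qed.

Context (Xs : Type) (g : Xs -> 'cV[R]_p) (x : nat -> Xs).

Definition info n : 'M[R]_p :=
  (n%:R)^-1 *: \sum_(1 <= i < n.+1) (g (x i) *m (g (x i))^T).

Lemma info_form n v w : (v^T *m info n *m w) 0 0 =
  n%:R^-1 * \sum_(1 <= i < n.+1) dot v (g (x i)) * dot w (g (x i)).
Proof.
rewrite /info -scalemxAr -scalemxAl mxE mulmx_sumr mulmx_suml summxE.
congr (_ * _); apply: eq_bigr => i _.
rewrite mulmxA -[_ *m _ *m w]mulmxA mxE big_ord_recl big_ord0 addr0 /dot; congr (_ * _).
by rewrite !mxE; apply: eq_bigr => k _; rewrite !mxE mulrC.
Qed.

Lemma info_sym n : (info n)^T = info n.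
Proof.
rewrite /info linearZ /= linear_sum /=; congr (_ *: _).
by apply: eq_bigr => i _; rewrite trmx_mul trmxK.
Qed.

(** A null vector of [info n] is orthogonal to every [g (x i)] with [i <= n], hence to those with
    [i <= m], against positive definiteness. *)
Lemma info_unit m n : (m <= n)%N -> posdef (info m) -> info n \in unitmx.
Proof.
move=> mn pd; rewrite unitmxE unitfE; apply/negP => /det0P[v v0 vM].
have v0' : v^T != 0 by rewrite -trmx0 (inj_eq trmx_inj).
have := pd _ v0'; rewrite info_form => pos.
have : (v^T^T *m info n *m v^T) 0 0 = 0 by rewrite trmxK vM mul0mx mxE.
rewrite info_form.
case: n mn {vM} => [|n] mn.
  by move: mn pos; rewrite leqn0 => /eqP ->; rewrite big_geq // mulr0 ltxx.
move/eqP; rewrite mulf_eq0 invr_eq0 pnatr_eq0 /=.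
rewrite (big_cat_nat _ (n := m.+1)) //= => /eqP s0.
have q0 a b : 0 <= \sum_(a <= i < b) dot v^T (g (x i)) * dot v^T (g (x i)).
  by apply: sumr_ge0 => i _; rewrite -expr2 sqr_ge0.
have : \sum_(1 <= i < m.+1) dot v^T (g (x i)) * dot v^T (g (x i)) = 0.
  by have := q0 1%N m.+1; have := q0 m.+1 n.+2; lra.
by move=> h; rewrite h mulr0 ltxx in pos.
Qed.

(** Both sides are [n] times the trace of [invmx (info n) *m info n], the identity of size [p]. *)
Lemma info_tr n : (0 < n)%N -> info n \in unitmx ->
  \sum_(1 <= i < n.+1) ((g (x i))^T *m invmx (info n) *m g (x i)) 0 0 =
  n%:R * p%:R.
Proof.
move=> n0 Mu.
have <- : \tr (invmx (info n) *m info n) = p%:R by rewrite mulVmx // mxtrace1.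
rewrite {3}/info -scalemxAr mxtraceZ mulrA divff ?pnatr_eq0 ?lt0n_neq0 // mul1r.
rewrite mulmx_sumr raddf_sum /=; apply: eq_bigr => i _.
by rewrite mulmxA mxtrace_mulC mulmxA /mxtrace big_ord1.
Qed.

(** A Chebyshev bound for [z |-> dot v (g z)] with [v = A *m g y]: its mean square under the design
    is [D >= p], and it is at least [(1 - s) * D] on [S]. The frame constant [L] of the initial
    points turns the bound [D] on this function into an l1 bound on [v]. *)
Lemma wynn_mass m n (y : Xs) (L s : R) (S : pred nat) :
  (0 < m <= n)%N -> posdef (info m) ->
  (forall z, ((g z)^T *m invmx (info n) *m g z) 0 0 <=
             ((g y)^T *m invmx (info n) *m g y) 0 0) ->
  (forall v b, (forall i, (1 <= i <= m)%N -> `|dot v (g (x i))| <= b) ->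
     \sum_k `|v k 0| <= L * b) ->
  0 <= s <= 1 ->
  (forall i, (1 <= i <= n)%N -> S i ->
     forall k, L * `|g (x i) k 0 - g y k 0| <= s) ->
  (\sum_(1 <= i < n.+1) (S i)%:R) * ((1 - s) ^+ 2 * p%:R) <= n%:R.
Proof.
move=> /andP[m0 mn] pd ymax Lb /andP[s0 s1] Sb.
have n0 : (0 < n)%N by apply: leq_trans mn.
have Mu := info_unit mn pd.
set A := invmx (info n) in ymax *.
have As : A^T = A by rewrite /A trmx_inv info_sym.
set D := ((g y)^T *m A *m g y) 0 0 in ymax *.
pose v := A *m g y.
have form z z' : ((A *m g z)^T *m info n *m (A *m g z')) 0 0 =
    dot (A *m g z) (g z').
  by rewrite /dot -mulmxA [info n *m _]mulmxA mulmxV // mul1mx.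
have dv z : dot (A *m g z) (g z) = ((g z)^T *m A *m g z) 0 0.
  by rewrite /dot trmx_mul As.
have n0R : 0 < n%:R :> R by rewrite ltr0n.
have q0 u : 0 <= (u^T *m info n *m u) 0 0.
  rewrite info_form mulr_ge0 ?invr_ge0 ?ler0n //.
  by apply: sumr_ge0 => i _; rewrite -expr2 sqr_ge0.
have sym u u' : (u^T *m info n *m u') 0 0 = (u'^T *m info n *m u) 0 0.
  by rewrite !info_form; congr (_ * _); apply: eq_bigr => i _; rewrite mulrC.
(* The form [info n] is nonnegative at [v + A *m g z] and at [v - A *m g z]; expanding,
   [2 * |dot v (g z)|] is at most [D] plus the variance at [z], itself at most [D]. *)
have vz z : `|dot v (g z)| <= D.
  have h1 := q0 (v + A *m g z); have h2 := q0 (v - A *m g z).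
  move: h1 h2.
  rewrite [(v + _)^T]linearD [(v - _)^T]linearB /= !mulmxDl !mulmxDr !mulNmx !mulmxN.
  have eD (a b : 'M[R]_1) : (a + b) 0 0 = a 0 0 + b 0 0 by rewrite mxE.
  have eN (a : 'M[R]_1) : (- a) 0 0 = - a 0 0 by rewrite mxE.
  rewrite !eD !eN (sym (A *m g z) v) !form !dv -/v -/D.
  have := ymax z; rewrite ler_norml; lra.
have Dp : p%:R <= D.
  have : n%:R * p%:R <= n%:R * D.
    rewrite -info_tr // mulr_natl -[X in D *+ X](subn1 n.+1) -sumr_const_nat.
    by apply: ler_sum.
  by rewrite ler_pM2l.
have D0 : 0 <= D by apply: le_trans Dp; rewrite ler0n.
have L0 : \sum_k `|v k 0| <= L * D by apply: Lb => i _; exact: vz.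
have vsum : \sum_(1 <= i < n.+1) dot v (g (x i)) ^+ 2 = n%:R * D.
  have := form y y; rewrite dv -/D info_form => <-.
  by rewrite mulrA divff ?gt_eqF // mul1r; apply: eq_bigr => i _; rewrite expr2.
have close i : (1 <= i <= n)%N -> S i -> (1 - s) * D <= dot v (g (x i)).
  move=> ni Si.
  have -> : dot v (g (x i)) = D + dot v (g (x i) - g y) by rewrite dotBr [dot v (g y)]dv -/D; ring.
  suff : `|dot v (g (x i) - g y)| <= s * D by rewrite ler_norml => /andP[]; lra.
  rewrite dotE (le_trans (ler_norm_sum _ _ _)) //.
  (* The general case divides by [L]; a nonpositive [L] forces [v = 0]. *)
  have [L1|L1] := leP L 0.
    have : \sum_k `|v k 0| <= 0.
      by apply: (le_trans L0); rewrite mulr_le0_ge0.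
    move=> h; have v0 k : `|v k 0| = 0.
      apply: (psumr_eq0P (P := predT) (F := fun k => `|v k 0|)) => //.
      by apply/eqP; rewrite eq_le h sumr_ge0.
    rewrite big1 ?mulr_ge0 // => k _.
    by move/eqP: (v0 k); rewrite normr_eq0 => /eqP ->; rewrite mul0r normr0.
  apply: (@le_trans _ _ (\sum_k `|v k 0| * (s / L))).
    apply: ler_sum => k _; rewrite normrM ler_wpM2l // ler_pdivlMr // mulrC.
    by rewrite !mxE; apply: Sb.
  rewrite -mulr_suml; apply: (@le_trans _ _ (L * D * (s / L))).
    by apply: ler_wpM2r => //; rewrite divr_ge0 // ltW.
  suff -> : L * D * (s / L) = s * D by [].
  by field; rewrite gt_eqF.
have key : (\sum_(1 <= i < n.+1) (S i)%:R) * ((1 - s) * D) ^+ 2 <= n%:R * D.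
  rewrite -vsum mulr_suml !big_nat; apply: ler_sum => i /andP[i1 i2].
  case: (boolP (S i)) => Si; last by rewrite mul0r sqr_ge0.
  rewrite mul1r ler_sqr ?nnegrE ?mulr_ge0 ?subr_ge0 //.
    by apply: close; rewrite ?i1.
  apply: le_trans (close i _ Si); rewrite ?i1 //.
  by rewrite mulr_ge0 ?subr_ge0.
(* For [p = 0] the claim is trivial; otherwise [D > 0] and one factor [D] cancels from [key]. *)
have [p0|p0] := posnP p; first by rewrite p0 !mulr0.
have D1 : 0 < D by apply: lt_le_trans Dp; rewrite ltr0n.
set c := \sum_(1 <= i < n.+1) _ in key *.
have c0 : 0 <= c by apply: sumr_ge0 => i _; rewrite ler0n.
have : c * ((1 - s) ^+ 2 * D) <= n%:R.
  by rewrite -(ler_pM2r D1); move: key; rewrite exprMn expr2 !mulrA.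
apply: le_trans; rewrite ler_wpM2l // ler_wpM2l //; exact: sqr_ge0.
Qed.

End design.

(** * Uniform constants from compactness *)

Section compactness.
Context (R : realType).

(** The image of an ultrafilter is an ultrafilter. One ultrafilter on the indices makes any number
    of sequences converge at once, in place of successive extraction of subsequences. *)
Lemma compact_ultra_cvg (T : topologicalType) (I : Type) (U : set_system I)
  (u : I -> T) : compact [set: T] -> UltraFilter U -> exists l : T, u @ U --> l.
Proof.
move=> cT UU.
have UP : ProperFilter U by exact: ultra_proper.
have fU : UltraFilter (u @ U).
  split=> [|G PG UG]; first exact: fmap_proper_filter.
  rewrite predeqE => A; split=> [GA|]; last exact: UG.
  have [//|UnA] := in_ultra_setVsetC (u @^-1` A) UU.
  have : G (A `&` ~` A) by apply: filterI => //; exact: UG.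
  by rewrite setICr => /filter_ex[].
move: cT; rewrite compact_ultra => /(_ _ fU) [|l [_ ul]]; first exact: filterT.
by exists l.
Qed.

(** Counterexamples for [eta = 1 / (n + 1)] converge along an ultrafilter. Separation keeps the
    limit points distinct, [mu] agrees there in the limit, and identifiability makes the limit
    parameter [thbar], although all parameters stay outside its ball. *)
Lemma separated_discrimination (Xs Th : pseudoMetricType R) (p : nat)
  (mu : Xs -> Th -> R) (thbar : Th) (r eps : R) :
  compact [set: Xs] -> compact [set: Th] ->
  continuous (fun q : Xs * Th => mu q.1 q.2) ->
  (forall (z : 'I_p -> Xs), injective z ->
     forall th th', (forall j, mu (z j) th = mu (z j) th') -> th = th') ->
  0 < r -> 0 < eps ->
  exists2 eta : R, 0 < eta &
    forall th, ~ ball thbar eps th ->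
    forall z : 'I_p -> Xs, (forall i j, i != j -> ~ ball (z i) r (z j)) ->
    exists j, eta <= `|mu (z j) th - mu (z j) thbar|.
Proof.
move=> cX cT muc ident r0 eps0; apply: contrapT => /forall2NP bad.
have {}bad (n : nat) : exists q : Th * ('I_p -> Xs),
    [/\ ~ ball thbar eps q.1,
        forall i j, i != j -> ~ ball (q.2 i) r (q.2 j) &
        forall j, `|mu (q.2 j) q.1 - mu (q.2 j) thbar| < n.+1%:R^-1].
  have [|] := bad n.+1%:R^-1; first by rewrite invr_gt0 ltr0Sn.
  move=> /existsNP[th /not_implyP[thb /existsNP[z /not_implyP[zr /forallNP zb]]]].
  by exists (th, z); split => // j; rewrite ltNge; apply/negP/zb.
have [q qP] := choice bad.
have [U [UU oU]] := @ultraFilterLemma nat \oo _.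
have UP : ProperFilter U by exact: ultra_proper.
have [th thU] := compact_ultra_cvg (fun n => (q n).1) cT UU.
have [z zU] := choice (fun j => compact_ultra_cvg (fun n => (q n).2 j) cX UU).
have muU j th' (t : nat -> Th) : t @ U --> th' ->
    (fun n => mu ((q n).2 j) (t n)) @ U --> mu (z j) th'.
  move=> tU; apply: (cvg_comp2 (zU j) tU (muc (z j, th'))).
suff th_thbar : th = thbar.
  have : \forall n \near U, ball th eps (q n).1 by exact: (cvg_ball thU).
  by rewrite th_thbar => /filter_ex[n]; case: (qP n).
apply: (ident z) => [i j zij|j].
  (* If two limit points coincided, the approximating points would both come within [r / 2] of them,
     hence within [r] of each other. *)
  apply: contrapT => /eqP ij.
  have r2 : 0 < r / 2 by rewrite divr_gt0.
  have h : \forall n \near U, ball (z i) (r / 2) ((q n).2 i) /\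
                              ball (z j) (r / 2) ((q n).2 j).
    by apply: filterI; [exact: (cvg_ball (zU i))|exact: (cvg_ball (zU j))].
  have [n [h1 h2]] := filter_ex h.
  case: (qP n) => _ /(_ i j ij) + _; apply.
  rewrite zij in h1.
  by apply: ball_splitr h1 h2.
have d0 : (fun n => mu ((q n).2 j) (q n).1 - mu ((q n).2 j) thbar) @ U --> (0 : R).
  have inv0 : (fun n => n.+1%:R^-1 : R) @ U --> (0 : R).
    by apply: cvg_trans (@cvg_harmonic R); exact: cvg_app.
  apply: norm_cvg0; apply: (squeeze_cvgr _ (cvg_cst 0) inv0).
  by apply: nearW => n; rewrite normr_ge0 /= ltW //; case: (qP n).
apply/eqP; rewrite -subr_eq0; apply/eqP/esym.
apply: (cvg_unique (@norm_hausdorff _ _) d0).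
by apply: cvgB (muU j _ _ thU) (muU j _ _ (cvg_cst thbar)).
Qed.

(** A radius that works near each point of the compact product works everywhere. Stating it for all
    small [r] lets finitely many functions share one radius. *)
Lemma uniform_modulus (Xs Th : pseudoMetricType R) (F : Xs -> Th -> R)
  (delta : R) :
  compact [set: Xs] -> compact [set: Th] ->
  continuous (fun q : Xs * Th => F q.1 q.2) -> 0 < delta ->
  \forall r \near 0^'+, forall th x x', ball x r x' ->
    `|F x' th - F x th| <= delta.
Proof.
move=> cX cT Fc d0.
have cXT : compact [set: Xs * Th] by rewrite -setXTT; exact: compact_setX.
have /compact_near_coveringP := cXT.
move=> /(_ _ (0 : R)^'+ (fun r q => forall x', ball q.1 r x' ->
    `|F x' q.2 - F q.1 q.2| <= delta) _) H.
suff : \forall r \near (0 : R)^'+, [set: Xs * Th] `<=`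
    (fun q : Xs * Th => forall x', ball q.1 r x' -> `|F x' q.2 - F q.1 q.2| <= delta).
  apply: filterS => r rP th x x' xx'; exact: (rP (x, th)).
apply: H => -[x th] _.
have /cvgrPdist_lt /(_ (delta / 2)) := Fc (x, th).
rewrite divr_gt0 // => /(_ isT) [[A B] [/= /nbhs_ballP[rho /= rho0 xA] Bth] AB].
have rho2 : 0 < rho / 2 by rewrite divr_gt0.
exists ((ball x (rho / 2) `*` B), [set r | r < rho / 2]).
  split=> /=; last exact: nbhs_right_lt.
  by exists (ball x (rho / 2), B) => //; split => //; exact: nbhsx_ballx.
move=> [[y t] r] /= [[xy Bt] rr] x' yx'.
have h1 := AB (y, t); have h2 := AB (x', t).
have {}h1 : `|F x th - F y t| < delta / 2.
  by apply: h1; split => //; apply: xA; apply: le_ball xy; lra.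
have {}h2 : `|F x th - F x' t| < delta / 2.
  apply: h2; split => //; apply: xA.
  by apply: (@ball_split _ _ y) => //; apply: le_ball yx'; exact: ltW.
rewrite (_ : F x' t - F y t = (F x th - F y t) - (F x th - F x' t)); last by ring.
by rewrite (le_trans (ler_normB _ _)) //; lra.
Qed.

(** Inverting the information matrix gives a constant [L0] at each parameter. Moving the vectors by
    less than [1 / (2 * L0)] at most doubles it, so the bound is locally uniform, and compactness
    makes it global. *)
Lemma uniform_frame_bound (Th : topologicalType) (p m : nat)
  (h : Th -> nat -> 'cV[R]_p) :
  compact [set: Th] -> (0 < m)%N ->
  (forall i k, continuous (fun th => h th i k 0)) ->
  (forall th, posdef (info (h th) id m)) ->
  exists L : R, forall th (v : 'cV[R]_p) (b : R),
    (forall i, (1 <= i <= m)%N -> `|dot v (h th i)| <= b) ->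
    \sum_k `|v k 0| <= L * b.
Proof.
move=> cT m0 hc pd.
have pt th : exists L : R, 0 < L /\ forall (v : 'cV[R]_p) (b : R),
    (forall i, (1 <= i <= m)%N -> `|dot v (h th i)| <= b) ->
    \sum_k `|v k 0| <= L * b.
  have Mu := info_unit (leqnn m) (pd th).
  set M := info (h th) id m in Mu.
  (* The sum comes from writing [v] as [M^-1 (M v)]; the added [1] makes the constant positive, so
     that it can be inverted. *)
  exists (1 + \sum_k m%:R^-1 * \sum_(1 <= i < m.+1) `|((h th i)^T *m invmx M) 0 k|).
  split.
    rewrite ltr_pwDl // sumr_ge0 // => k _; rewrite mulr_ge0 ?invr_ge0 //.
    exact: sumr_ge0.
  move=> v b vb.
  have b0 : 0 <= b by apply: le_trans (vb 1%N _); rewrite ?m0.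
  rewrite mulrDl mul1r ler_wpDl // mulr_suml; apply: ler_sum => k _.
  have -> : v k 0 = m%:R^-1 *
      \sum_(1 <= i < m.+1) dot v (h th i) * ((h th i)^T *m invmx M) 0 k.
    have -> : v k 0 = (v^T *m M *m invmx M) 0 k by rewrite mulmxK // mxE.
    rewrite {1}/M /info -scalemxAr -scalemxAl mxE mulmx_sumr mulmx_suml summxE.
    congr (_ * _); apply: eq_bigr => i _.
    by rewrite mulmxA -[_ *m _ *m invmx M]mulmxA mxE big_ord_recl big_ord0 addr0.
  rewrite normrM ger0_norm ?invr_ge0 // -mulrA; apply: ler_wpM2l.
    by rewrite invr_ge0.
  rewrite (le_trans (ler_norm_sum _ _ _)) // mulr_suml !big_nat.
  by apply: ler_sum => i im; rewrite normrM mulrC ler_wpM2l // vb.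
have /compact_near_coveringP := cT.
move=> /(_ R +oo%R (fun L th => forall (v : 'cV[R]_p) (b : R),
    (forall i, (1 <= i <= m)%N -> `|dot v (h th i)| <= b) ->
    \sum_k `|v k 0| <= L * b) _) H.
suff /filter_ex[L LP] : \forall L \near +oo%R, [set: Th] `<=`
   (fun th => forall (v : 'cV[R]_p) (b : R),
    (forall i, (1 <= i <= m)%N -> `|dot v (h th i)| <= b) ->
    \sum_k `|v k 0| <= L * b).
  by exists L => th; exact: LP.
apply: H => th0 _.
have [L0 [L00 L0P]] := pt th0.
have e0 : 0 < (2 * L0)^-1 by rewrite invr_gt0 mulr_gt0.
have near_h : \forall th \near th0, forall (i : 'I_m.+1) (k : 'I_p),
    `|h th0 i k 0 - h th i k 0| < (2 * L0)^-1.
  apply: filter_forall => i; apply: filter_forall => k.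
  by have /cvgrPdist_lt := hc i k th0; exact.
exists ([set th | forall (i : 'I_m.+1) (k : 'I_p),
    `|h th0 i k 0 - h th i k 0| < (2 * L0)^-1], [set L | 2 * L0 < L]).
  by split => //=; apply: nbhs_pinfty_gt; exact: num_real.
move=> [th L] /= [hth LL] v b vb.
have b0 : 0 <= b by apply: le_trans (vb 1%N _); rewrite ?m0.
set N := \sum_k `|v k 0|.
have N0 : 0 <= N by exact: sumr_ge0.
(* The perturbation costs [N / 2], which is absorbed into the left-hand side. *)
have : N <= L0 * (b + N * (2 * L0)^-1).
  apply: L0P => i im.
  have -> : dot v (h th0 i) = dot v (h th i) + dot v (h th0 i - h th i).
    by rewrite dotBr; ring.
  rewrite (le_trans (ler_normD _ _)) // lerD ?vb //.
  rewrite dotE (le_trans (ler_norm_sum _ _ _)) // /N mulr_suml.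
  apply: ler_sum => k _; rewrite normrM ler_wpM2l // !mxE.
  have im1 : (i < m.+1)%N by case/andP: im.
  exact: ltW (hth (Ordinal im1) k).
have -> : L0 * (b + N * (2 * L0)^-1) = L0 * b + N / 2.
  by field; rewrite gt_eqF.
move=> NL; have : N <= 2 * L0 * b by lra.
by move/le_trans; apply; rewrite ler_wpM2r // ltW.
Qed.

End compactness.

(** * Coverings by few balls and visits to small balls *)

Section counting.
Context (R : realType) (Xs : pseudoMetricType R).

Definition visits (x : nat -> Xs) (S : set Xs) (n : nat) : R :=
  \sum_(1 <= i < n.+1) (`[< S (x i) >])%:R.

Lemma visits_rec x S n : visits x S n.+1 = visits x S n + (`[< S (x n.+1) >])%:R.
Proof. by rewrite /visits big_nat_recr. Qed.

Lemma visits_le x S n : visits x S n <= n%:R.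
Proof.
elim: n => [|n IH]; first by rewrite /visits big_geq.
by rewrite visits_rec -addn1 natrD lerD // lern1 leq_b1.
Qed.

Lemma visits_sub x S S' n : S `<=` S' -> visits x S n <= visits x S' n.
Proof.
move=> SS'; apply: ler_sum => i _; rewrite ler_nat.
by case: asboolP => // Sx; rewrite asboolT //; exact: SS'.
Qed.

(** Greedy choice: as long as the chosen points of [S] do not cover it, an uncovered point extends
    the separated family, which cannot reach [p] members. *)
Lemma separated_cover (r : R) (p : nat) (S : set Xs) :
  (forall z : 'I_p -> Xs, (forall i j, i != j -> ~ ball (z i) r (z j)) ->
     exists j, ~ S (z j)) ->
  exists2 s : seq Xs, (size s < p)%N &
    forall x, S x -> exists2 c, c \in s & ball c r x.
Proof.
move=> nosep.
have grow k : (exists2 s : seq Xs, (size s < k)%N &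
      forall x, S x -> exists2 c, c \in s & ball c r x) \/
    exists s : seq Xs, [/\ size s = k, {in s, forall x, S x} &
      pairwise (fun a b => ~~ `[< ball a r b >]) s].
  elim: k => [|k [[s sk sS]|[s [sk sS sp]]]]; first by right; exists [::].
    by left; exists s => //; exact: ltnW.
  have [H|/existsNP[x /not_implyP[Sx H]]] :=
      pselect (forall x, S x -> exists2 c, c \in s & ball c r x).
    by left; exists s => //; rewrite sk.
  right; exists (x :: s); split => /=; first by rewrite sk.
    by move=> y; rewrite inE => /orP[/eqP ->//|]; exact: sS.
  rewrite sp andbT; apply/allP => c cs; apply/asboolPn => xc; apply: H.
  by exists c => //; exact: ball_sym.
have [//|[s [sp sS ps]]] := grow p.
case: p sp nosep grow => [|p] sp nosep grow.
  by have [[]] := nosep (fun i => False_rect _ (notF (valP i))) (fun i => False_rect _ (notF (valP i))).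
have x0 : Xs by case: s sp {sS ps} => // a.
have [i j ij|j []] := nosep (fun i : 'I_p.+1 => nth x0 s i); last first.
  by apply: sS; rewrite mem_nth // sp.
move/(pairwiseP x0) in ps.
have : (i != j :> nat) by [].
rewrite neq_ltn => /orP[h|h].
  by apply/asboolPn; apply: ps; rewrite ?inE ?sp.
by move=> /ball_sym; apply/asboolPn; apply: ps; rewrite ?inE ?sp.
Qed.

(** Passes from balls around the next point to balls with a fixed centre. When [x n.+1] falls in
    [ball c (r / 2)], that ball lies in [ball (x n.+1) r], whose earlier visits are bounded;
    otherwise the count does not change. The extra [nst.+1] covers the initial stage and the latest
    visit. *)
Lemma visits_ball (x : nat -> Xs) (nst : nat) (r q : R) : 0 < q ->
  (forall n, (nst <= n)%N -> visits x (ball (x n.+1) r) n * q <= n%:R) ->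
  forall n c, visits x (ball c (r / 2)) n * q <= n%:R + nst.+1%:R * q.
Proof.
move=> q0 H n c; elim: n => [|n IH].
  by rewrite /visits big_geq // mul0r add0r mulr_ge0 // ltW.
have [nn|nn] := leqP nst n; last first.
  have : visits x (ball c (r / 2)) n.+1 <= nst.+1%:R.
    by rewrite (le_trans (visits_le _ _ _)) // ler_nat ltnW.
  by move/(ler_wpM2r (ltW q0))/le_trans; apply; rewrite lerDr.
rewrite visits_rec; case: asboolP => [cx|_]; last first.
  by rewrite addr0 (le_trans IH) // lerD2r ler_nat.
have : visits x (ball c (r / 2)) n * q <= n%:R.
  apply: le_trans (H n nn); rewrite ler_wpM2r //; first exact: ltW.
  by apply: visits_sub => y cy; apply: (ball_splitr cx cy).
have : 0 <= nst%:R * q by rewrite mulr_ge0 // ltW.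
rewrite mulrDl mul1r -addn1 natrD -[nst.+1]addn1 natrD mulrDl; lra.
Qed.

End counting.

(** * Linear growth of the discrepancy away from the true parameter *)

Section discrepancy.
Context (R : realType) (Xs Th : pseudoMetricType R).

Definition discrepancy (mu : Xs -> Th -> R) (x : nat -> Xs) th th' n : R :=
  \sum_(1 <= i < n.+1) (mu (x i) th - mu (x i) th') ^+ 2.

(* [p - 1] balls of radius [r / 2] together receive a proportion of at most
   about [(p - 1) / (p - 1/2) < 1] of the observations ([p - 1/2] could be any
   number strictly between [p - 1] and [p]), whereas the points at
   which [mu _ th] and [mu _ thbar] nearly agree lie in [p - 1] such balls. *)
Lemma discrepancy_linear (p nst : nat) (mu : Xs -> Th -> R) (thbar : Th)
  (r eps : R) : (0 < p)%N ->
  compact [set: Xs] -> compact [set: Th] ->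
  continuous (fun q : Xs * Th => mu q.1 q.2) ->
  (forall (z : 'I_p -> Xs), injective z ->
     forall th th', (forall j, mu (z j) th = mu (z j) th') -> th = th') ->
  0 < r -> 0 < eps ->
  exists2 c : R, 0 < c & exists N, forall x : nat -> Xs,
    (forall n, (nst <= n)%N ->
       visits x (ball (x n.+1) r) n * (p%:R - 2^-1) <= n%:R) ->
    forall n th, (N <= n)%N -> ~ ball thbar eps th ->
    c * n%:R <= discrepancy mu x th thbar n.
Proof.
move=> p0 cX cT muc ident r0 eps0.
have r2 : 0 < r / 2 by rewrite divr_gt0.
have [eta eta0 etaP] := separated_discrimination thbar cX cT muc ident r2 eps0.
set q : R := p%:R - 2^-1.
have p1 : 1 <= p%:R :> R by rewrite ler1n.
have q0 : 0 < q by rewrite /q; lra.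
have eta2 : 0 < eta ^+ 2 by rewrite exprn_gt0.
(* Up to an additive term at most [q * K], [q] times the visits to [S] is at most [(p - 1) * n]. As
   [q - (p - 1) = 1/2], once [4 * q * K <= n] at least [n / (4 * q)] observations fall outside [S],
   each contributing [eta ^+ 2]. *)
exists (eta ^+ 2 / (4 * q)); first by rewrite divr_gt0 // mulr_gt0.
pose K : R := p%:R * nst.+1%:R.
exists (Num.truncn (4 * q * K)).+1 => x xr n th Nn thb.
have Kn : 4 * q * K <= n%:R.
  rewrite ltW // (lt_le_trans (truncnS_gt _)) //.
  by rewrite ler_nat.
pose S := [set y | `|mu y th - mu y thbar| < eta].
have [s sp sS] : exists2 s : seq Xs, (size s < p)%N &
    forall y, S y -> exists2 c, c \in s & ball c (r / 2) y.
  apply: separated_cover => z /(etaP th thb z)[j]; rewrite leNgt => /negP h.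
  by exists j.
have vS : visits x S n <= \sum_(c <- s) visits x (ball c (r / 2)) n.
  rewrite /visits exchange_big /=; apply: ler_sum => i _.
  case: asboolP => [/sS[c cs xc]|_]; last by rewrite sumr_ge0.
  by rewrite (big_rem c) //= asboolT // lerDl sumr_ge0.
have vSq : visits x S n * q <= (p%:R - 1) * (n%:R + nst.+1%:R * q).
  apply: (le_trans (ler_wpM2r (ltW q0) vS)); rewrite mulr_suml.
  apply: (@le_trans _ _ (\sum_(c <- s) (n%:R + nst.+1%:R * q))).
    by apply: ler_sum => c _; exact: visits_ball.
  rewrite big_const_seq count_predT iter_addr_0 -[leLHS]mulr_natl.
  apply: ler_wpM2r; first by rewrite addr_ge0 ?mulr_ge0 // ltW.
  by rewrite lerBrDr natr1 ler_nat.
have dS : eta ^+ 2 * (n%:R - visits x S n) <= discrepancy mu x th thbar n.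
  rewrite -[n in n%:R](subn1 n.+1) -sumr_const_nat -sumrB mulr_sumr.
  apply: ler_sum => i _; case: asboolP => [_|]; first by rewrite subrr mulr0 sqr_ge0.
  rewrite /S /= => /negP; rewrite -leNgt subr0 mulr1 => h.
  by rewrite -[leRHS]real_normK ?num_real // ler_sqr ?nnegrE // ltW.
apply: le_trans dS; rewrite -mulrA ler_wpM2l ?(ltW eta2) //.
rewrite mulrC ler_pdivrMr ?mulr_gt0 //.
have : 0 <= nst.+1%:R * q by rewrite mulr_ge0 // ltW.
move: vSq Kn; rewrite /K /q.
rewrite [_ * (p%:R - 2^-1)]mulrC; lra.
Qed.

End discrepancy.

(** * The mass bound along the Wynn algorithm *)

Section wynn.
Context (R : realType) (Xs Th : pseudoMetricType R) (p : nat).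

(** The radius is fixed before the trajectory and the estimators: the frame constant of the initial
    design and the modulus of continuity of [f] are both uniform in the parameter. *)
Lemma wynn_visits (f : Th -> Xs -> 'cV[R]_p) (nst : nat) (xst : nat -> Xs) :
  (0 < p)%N -> compact [set: Xs] -> compact [set: Th] ->
  continuous (fun q : Xs * Th => f q.2 q.1) ->
  (forall th, posdef (info_emp f xst nst th)) ->
  exists2 r : R, 0 < r & forall (x : nat -> Xs) (th : nat -> Th),
    (forall i, (1 <= i <= nst)%N -> x i = xst i) ->
    (forall n, (nst <= n)%N -> forall y : Xs,
       let Minv := invmx (info_emp f x n (th n)) in
       ((f (th n) y)^T *m Minv *m f (th n) y) 0 0
       <= ((f (th n) (x n.+1))^T *m Minv *m f (th n) (x n.+1)) 0 0) ->
    forall n, (nst <= n)%N ->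
      visits x (ball (x n.+1) r) n * (p%:R - 2^-1) <= n%:R.
Proof.
move=> p0 cX cT fc pd.
have p1 : 1 <= p%:R :> R by rewrite ler1n.
have [[th0 _]|noTh] := pselect (exists th : Th, True); last first.
  by exists 1 => // x th; case: noTh; exists (th 0%N).
(* With no initial points the information matrix is zero, which is not positive definite since
   [p > 0]. *)
have nst0 : (0 < nst)%N.
  rewrite lt0n; apply/eqP => n0; move: (pd th0); rewrite n0 => /(_ (const_mx 1)).
  rewrite /info_emp invr0 scale0r mulmx0 mul0mx mxE ltxx => H.
  suff : false by [].
  apply: H; apply/eqP => /matrixP/(_ (Ordinal p0) 0).
  by rewrite !mxE => /eqP; rewrite oner_eq0.
have fkc k : continuous (fun q : Xs * Th => f q.2 q.1 k 0).
  move=> q; apply: (continuous_comp (f := fun q : Xs * Th => f q.2 q.1)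
    (g := fun M : 'cV[R]_p => M k 0)); [exact: fc|exact: coord_continuous].
have hc i k : continuous (fun th => f th (xst i) k 0).
  move=> th; apply: (continuous_comp (f := fun th => (xst i, th))
    (g := fun q : Xs * Th => f q.2 q.1 k 0)); last exact: fkc.
  by apply: cvg_pair; [exact: cvg_cst|exact: cvg_id].
have [L LP] := uniform_frame_bound cT nst0 hc pd.
(* With [p * s = 1/4], [(1 - s) ^+ 2 * p] equals [p - 1/2 + p * s ^+ 2]. *)
pose s : R := (4 * p%:R)^-1.
have s0 : 0 < s by rewrite invr_gt0 mulr_gt0 // ltr0n.
have d0 : 0 < s / (`|L| + 1) by rewrite divr_gt0 // ltr_wpDl.
have modulus (k : 'I_p) := @uniform_modulus _ _ _ (fun x th => f th x k 0)
  (s / (`|L| + 1)) cX cT (fkc k) d0.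
have [r [r0 rP]] : exists r : R, 0 < r /\ forall (k : 'I_p) th x x',
    ball x r x' -> `|f th x' k 0 - f th x k 0| <= s / (`|L| + 1).
  apply: (filter_ex (F := (0 : R)^'+)); apply: filterI.
    exact: nbhs_right_gt.
  exact: (@filter_forall R 'I_p (fun k r => forall th x x', ball x r x' ->
    `|f th x' k 0 - f th x k 0| <= s / (`|L| + 1)) (0 : R)^'+ _ modulus).
exists r => // x th xE xmax n nn.
have pdx : posdef (info (f (th n)) x nst).
  suff -> : info (f (th n)) x nst = info_emp f xst nst (th n) by exact: pd.
  congr (_ *: _); rewrite !big_nat; apply: eq_bigr => i ni.
  by rewrite xE.
have := @wynn_mass _ _ _ (f (th n)) x nst n (x n.+1) L s
  (fun i => `[< ball (x n.+1) r (x i) >]).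
rewrite nst0 nn => /(_ isT pdx (xmax n nn)) H.
have {}H : visits x (ball (x n.+1) r) n * ((1 - s) ^+ 2 * p%:R) <= n%:R.
  apply: H.
  - by move=> v b vb; apply: (LP (th n)) => i im; rewrite -xE //; exact: vb.
  - rewrite ltW //= /s invf_le1 ?mulr_gt0 ?ltr0n //; lra.
  - move=> i _ /asboolP xi k.
    rewrite (le_trans (ler_wpM2r (normr_ge0 _) (ler_norm L))) //.
    apply: (le_trans (ler_wpM2l (normr_ge0 _) (rP k _ _ _ xi))).
    rewrite mulrCA ler_piMr ?(ltW s0) // ler_pdivrMr ?mul1r ?lerDl //.
apply: le_trans H; apply: ler_wpM2l; first by apply: sumr_ge0.
have ps : p%:R * s = 4^-1 by rewrite /s; field; rewrite pnatr_eq0 -lt0n.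
have -> : (1 - s) ^+ 2 * p%:R = p%:R - 2 * (p%:R * s) + p%:R * s ^+ 2 by ring.
have : 0 <= p%:R * s ^+ 2 by rewrite mulr_ge0 ?sqr_ge0.
by rewrite ps; lra.
Qed.

End wynn.

(** * Measurability and conditional inequalities for sub-sigma-fields *)

Definition meas_wrt d (Omega : measurableType d) (R : realType)
  (G : set (set Omega)) (V : Omega -> R) : Prop :=
  measurable_fun [set: g_sigma_algebraType G] (V : g_sigma_algebraType G -> R).

Section sub_sigma_field.
Context d (Omega : measurableType d) (R : realType).
Implicit Types (G : set (set Omega)) (V : Omega -> R).
Import HBNNSimple.

(** In [meas_wrt], [G] generates a measurable type, so that the closure properties of measurable
    functions apply to it. Open intervals suffice, as they generate the Borel sets. *)
Lemma borel_meas_wrtP G V : sub_sigma_field G -> borel_meas_wrt G V ->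
  meas_wrt G V.
Proof.
move=> [sG _] GV; apply: (measurability _ (RGenOpens.measurableE R)).
move=> _ [_ [a [b ->] <-]]; rewrite setTI measurable_g_measurableTypeE //.
by apply: GV; exact: interval_open.
Qed.

Lemma meas_wrt_sub G G' V : sub_sigma_field G -> sub_sigma_field G' ->
  G `<=` G' -> meas_wrt G V -> meas_wrt G' V.
Proof.
move=> [sG _] [sG' _] GG' GV _ B mB.
rewrite measurable_g_measurableTypeE //; apply: GG'.
by rewrite -[G]measurable_g_measurableTypeE //; exact: GV.
Qed.

Lemma meas_wrt_measurable G V : sub_sigma_field G -> meas_wrt G V ->
  measurable_fun [set: Omega] V.
Proof.
move=> [sG Gm] GV _ B mB; apply: Gm.
by rewrite -[G]measurable_g_measurableTypeE //; exact: GV.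
Qed.

Context (mu : {measure set Omega -> \bar R}).

(** The integrated form of the fact that a nonnegative [G]-measurable factor preserves a conditional
    inequality: it holds for simple factors by linearity and passes to [V] by monotone convergence.
    Nonnegativity allows infinite integrals. *)
Lemma pull_out_le G (A B V : Omega -> R) : sub_sigma_field G ->
  measurable_fun setT A -> measurable_fun setT B ->
  (forall w, 0 <= A w) -> (forall w, 0 <= B w) ->
  (forall S, G S -> (\int[mu]_(w in S) (A w)%:E <= \int[mu]_(w in S) (B w)%:E)%E) ->
  meas_wrt G V -> (forall w, 0 <= V w) ->
  (\int[mu]_w (V w * A w)%:E <= \int[mu]_w (V w * B w)%:E)%E.
Proof.
move=> GG mA mB A0 B0 AB GV V0; have [sG Gm] := GG.
(* Retyping the domain makes the level sets of the simple approximations belong to [G]. *)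
pose V' : g_sigma_algebraType G -> R := V.
have mV : measurable_fun setT (EFin \o V') by exact/measurable_EFinP.
pose g := nnsfun_approx measurableT mV.
have Gg n y : G (g n @^-1` [set y]).
  have : G.-sigma.-measurable (g n @^-1` [set y]) by [].
  by rewrite {1}measurable_g_measurableTypeE.
have mg n : measurable_fun [set: Omega] (g n : Omega -> R).
  by apply: (meas_wrt_measurable GG); exact: measurable_funPT.
have step (C : Omega -> R) : measurable_fun setT C -> (forall w, 0 <= C w) ->
  forall n, (\int[mu]_w (g n w * C w)%:E =
   \sum_(y <- fset_set (range (g n)))
      y%:E * \int[mu]_(w in g n @^-1` [set y]) (C w)%:E)%E.
  move=> mC C0 n.
  transitivity (\int[mu]_w (\sum_(y <- fset_set (range (g n)))
      (y%:E * ((C w)%:E * (\1_(g n @^-1` [set y]) w)%:E)))%E)%E.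
    apply: eq_integral => w _; rewrite {1}(fimfunE (g n)) fsbig_finite //=.
    by rewrite mulr_suml -sumEFin; apply: eq_bigr => y _; rewrite mulrAC -mulrA.
  rewrite ge0_integral_sum //; last 2 first.
  - move=> y; apply/measurable_EFinP; apply: measurable_funM => //.
    by apply: measurable_funM => //; apply: measurable_indic; exact: Gm.
  - move=> y w _; rewrite -EFinM lee_fin indicE.
    case: (boolP (w \in _)) => [/set_mem <-|_]; last by rewrite !mulr0.
    by rewrite mulr1 mulr_ge0.
  apply: eq_bigr => y _; rewrite [in RHS]integral_mkcond epatch_indic.
  have [y0|y0] := leP 0 y.
    rewrite ge0_integralZl_EFin // => [w _|].
      by rewrite mule_ge0 ?lee_fin.
    by apply/measurable_EFinP/measurable_funM/measurable_indic/Gm.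
  rewrite (_ : _ @^-1` _ = set0) ?integral0_eq ?mule0 // => [w _|w _|].
  - by rewrite indic0 mule0.
  - by rewrite indic0 !mule0.
  - by apply/seteqP; split => // w /= gw; move: y0; rewrite -gw ltNge fun_ge0.
have lim (C : Omega -> R) : measurable_fun setT C -> (forall w, 0 <= C w) ->
    (\int[mu]_w (g n w * C w)%:E)%E @[n --> \oo] --> (\int[mu]_w (V w * C w)%:E)%E.
  move=> mC C0.
  rewrite (_ : \int[mu]_w (V w * C w)%:E =
    \int[mu]_w limn (fun n => (g n w * C w)%:E))%E; last first.
    apply: eq_integral => w _; apply/esym/cvg_lim => //.
    under eq_fun do rewrite EFinM; rewrite EFinM.
    apply: cvgeZr => //.
    by apply: (cvg_nnsfun_approx measurableT mV) => // x _; rewrite lee_fin.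
  apply: cvg_monotone_convergence => //.
  - by move=> n; apply/measurable_EFinP/measurable_funM.
  - by move=> n w _; rewrite lee_fin mulr_ge0.
  - move=> w _ m n mn; rewrite lee_fin ler_wpM2r //.
    by have /lefP := nd_nnsfun_approx measurableT mV mn; exact.
apply: (lee_cvg_to (lim A mA A0) (lim B mB B0)).
apply: nearW => n; rewrite !step //; rewrite !big_seq; apply: lee_sum => y yg.
apply: lee_wpmul2l; last exact: AB.
by move: yg; rewrite in_fset_set // => /set_mem[w _ <-]; rewrite lee_fin.
Qed.

End sub_sigma_field.

(** * Reflected walks and averages along squares *)

Section lindley.
Context (R : realType).

(* Reflecting the walk at [0] makes its value nonnegative, as needed for
   multiplying a one-sided conditional inequality, and still dominates the sum. *)
Fixpoint lindley (a : nat -> R) (j : nat) : R :=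
  if j is j'.+1 then Num.max 0 (lindley a j' + a j') else 0.

Lemma lindley_ge0 (a : nat -> R) j : 0 <= lindley a j.
Proof. by case: j => //= j; rewrite le_max lexx. Qed.

Lemma sum_le_lindley (a : nat -> R) j : \sum_(i < j) a i <= lindley a j.
Proof.
elim: j => [|j IH]; first by rewrite big_ord0.
by rewrite big_ord_recr /= le_max orbC lerD2r IH.
Qed.

(** Telescoping of [1 / x ^+ 2 <= 2 / x - 2 / (x + 1)] for [x >= 1]. *)
Lemma sum_inv_sqr (N : nat) :
  \sum_(0 <= k < N) (k.+1%:R ^+ 2)^-1 <= 3 - 2 / N.+1%:R :> R.
Proof.
elim: N => [|N IH]; first by rewrite big_geq // divr1; lra.
rewrite big_nat_recr //=; apply: (le_trans (lerD IH (lexx _))).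
rewrite -[N.+2]addn1 natrD; set x : R := N.+1%:R.
have x1 : 1 <= x by rewrite ler1n.
have x0 : 0 < x by lra.
rewrite -subr_ge0.
have -> : 3 - 2 / (x + 1) - (3 - 2 / x + (x ^+ 2)^-1) =
    (x - 1) / (x ^+ 2 * (x + 1)).
  by field; apply/andP; split; lra.
by rewrite divr_ge0 ?subr_ge0 // mulr_ge0 ?sqr_ge0 //; lra.
Qed.

Lemma square_bracket (n : nat) : (0 < n)%N ->
  exists k, (k.+1 ^ 2 <= n < k.+2 ^ 2)%N.
Proof.
elim: n => // -[|n] IH _; first by exists 0%N.
have [//|k /andP[k1 k2]] := IH.
have [h|h] := ltnP n.+2 (k.+2 ^ 2); first by exists k; rewrite h ltnW.
exists k.+1; rewrite h /=.
have -> : n.+2 = (k.+2 ^ 2)%N by apply/eqP; rewrite eqn_leq h andbT.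
by rewrite ltn_sqr.
Qed.

(** With [K = k.+1] and [n] between [K ^ 2] and [(K + 1) ^ 2], the sum splits at [K ^ 2]. Each piece
    is dominated by a reflected walk, eventually at most [e / 2 * K ^+ 2]. The remainder has at most
    [2 * K] terms, which fixes the range of [j]. *)
Lemma lindley_average (a : nat -> R) :
  ((k.+1%:R ^+ 4)^-1 * (lindley a (k.+1 ^ 2) ^+ 2 +
     \sum_(j < (2 * k.+1).+1) lindley (fun i => a (k.+1 ^ 2 + i)%N) j ^+ 2))
    @[k --> \oo] --> (0 : R) ->
  forall e, 0 < e -> \forall n \near \oo, \sum_(i < n) a i <= e * n%:R.
Proof.
move=> /cvgrPdist_lt cv e e0.
have e2 : 0 < (e / 2) ^+ 2 by rewrite exprn_gt0 // divr_gt0.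
have [N _ NP] := cv _ e2.
exists (N.+1 ^ 2)%N => // n /= Nn.
have n0 : (0 < n)%N by apply: leq_trans Nn; rewrite expn_gt0.
have [k /andP[k1 k2]] := square_bracket n0.
have Nk : (N <= k)%N.
  by have := leq_ltn_trans Nn k2; rewrite ltn_sqr ltnS.
pose X := lindley a (k.+1 ^ 2); pose K : R := k.+1%:R.
pose Y := \sum_(j < (2 * k.+1).+1) lindley (fun i => a (k.+1 ^ 2 + i)%N) j ^+ 2.
have : `|0 - (K ^+ 4)^-1 * (X ^+ 2 + Y)| < (e / 2) ^+ 2 by exact: (NP k Nk).
rewrite sub0r normrN.
have K0 : 0 < K ^+ 4 :> R by rewrite exprn_gt0 // ltr0n.
have Y0 : 0 <= Y by apply: sumr_ge0 => j _; exact: sqr_ge0.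
rewrite ger0_norm; last by rewrite mulr_ge0 ?invr_ge0 ?addr_ge0 ?sqr_ge0 // ltW.
rewrite mulrC ltr_pdivrMr // => XY.
have sq (x : R) : 0 <= x -> x ^+ 2 < (e / 2) ^+ 2 * K ^+ 4 -> x <= e / 2 * K ^+ 2.
  move=> x0; rewrite (_ : _ * K ^+ 4 = (e / 2 * K ^+ 2) ^+ 2); last by ring.
  rewrite ltr_sqr ?nnegrE // => [/ltW //|].
  by rewrite mulr_ge0 ?sqr_ge0 // divr_ge0 // ltW.
have jk : (n - k.+1 ^ 2 < (2 * k.+1).+1)%N.
  rewrite ltn_subLR // (leq_trans k2) //.
  rewrite -!mulnn; lia.
have -> : n = (k.+1 ^ 2 + (n - k.+1 ^ 2))%N by rewrite subnKC.
rewrite big_split_ord /= natrD.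
have h1 : X <= e / 2 * K ^+ 2.
  by apply: sq; [exact: lindley_ge0|apply: le_lt_trans XY; rewrite lerDl].
have h2 : lindley (fun i => a (k.+1 ^ 2 + i)%N) (n - k.+1 ^ 2) <= e / 2 * K ^+ 2.
  apply: sq; first exact: lindley_ge0.
  apply: le_lt_trans XY; rewrite ler_wpDl ?sqr_ge0 //.
  by rewrite /Y (bigD1 (Ordinal jk)) //= lerDl sumr_ge0 // => i _; exact: sqr_ge0.
have h3 := sum_le_lindley a (k.+1 ^ 2).
have h4 := sum_le_lindley (fun i => a (k.+1 ^ 2 + i)%N) (n - k.+1 ^ 2).
have : 0 <= e * (n - k.+1 ^ 2)%:R by rewrite mulr_ge0 // ltW.
rewrite mulrDr natrX -/K; move: h1 h2 h3 h4; rewrite -/X; lra.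
Qed.

End lindley.

(** * A one-sided strong law for conditionally ordered sequences *)

Section strong_law.
Context d (Omega : measurableType d) (R : realType) (P : probability Omega R).

(** The series of the [v k] has a finite integral, hence converges almost everywhere, and its terms
    vanish in the limit. *)
Lemma ae_cvg0_of_summable (v : nat -> Omega -> R) (L : R) :
  (forall k, measurable_fun setT (v k)) -> (forall k w, 0 <= v k w) ->
  (forall N, \sum_(0 <= k < N) (\int[P]_w (v k w)%:E) <= L%:E)%E ->
  {ae P, forall w, v k w @[k --> \oo] --> (0 : R)}.
Proof.
move=> mv v0 vL.
pose f w := (\sum_(k <oo) (v k w)%:E)%E.
have f0 w : (0 <= f w)%E by apply: nneseries_ge0 => k _ _; rewrite lee_fin.
have mvE k : measurable_fun setT (fun w => (v k w)%:E) by exact/measurable_EFinP.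
have mf : measurable_fun setT f.
  by apply: ge0_emeasurable_sum => // k w _ _; rewrite lee_fin.
have If : P.-integrable setT f.
  apply/integrableP; split => //.
  under eq_integral do rewrite gee0_abs //.
  rewrite integral_nneseries //; last by move=> k w _; rewrite lee_fin.
  apply: (@le_lt_trans _ _ L%:E); last exact: ltry.
  apply: lime_le.
    by apply: is_cvg_nneseries => k _ _; apply: integral_ge0 => w _; rewrite lee_fin.
  by apply: nearW => N; exact: vL.
apply: filterS (integrable_ae measurableT If) => w /(_ Logic.I) fw.
apply: cvg_series_cvg_0; apply: nondecreasing_is_cvgn.
  apply/nondecreasing_seqP => n; rewrite !/(series _ _) /= big_nat_recr //=.
  by rewrite lerDl.
exists (fine (f w)) => _ [n _ <-].
rewrite -lee_fin fineK // /series /= -sumEFin.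
by apply: nneseries_lim_ge => k _ _; rewrite lee_fin.
Qed.

Context (F : nat -> set (set Omega)).
Hypothesis FF : forall n, sub_sigma_field (F n).
Hypothesis Finc : forall n, F n `<=` F n.+1.
Context (A B : nat -> Omega -> R) (C : R).
Hypothesis mA : forall i, meas_wrt (F i.+1) (A i).
Hypothesis mB : forall i, meas_wrt (F i.+1) (B i).
Hypothesis A0 : forall i w, 0 <= A i w.
Hypothesis B0 : forall i w, 0 <= B i w.
Hypothesis AB : forall i S, F i S ->
  (\int[P]_(w in S) (A i w)%:E <= \int[P]_(w in S) (B i w)%:E)%E.
Hypothesis A2 : forall i, (\int[P]_w (A i w ^+ 2)%:E <= C%:E)%E.
Hypothesis B2 : forall i, (\int[P]_w (B i w ^+ 2)%:E <= C%:E)%E.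

Let U m j w := lindley (fun i => A (m + i)%N w - B (m + i)%N w) j.

Let mU m j : meas_wrt (F (m + j)) (U m j).
Proof.
elim: j => [|j IH]; first exact: measurable_cst.
have {}IH : meas_wrt (F (m + j).+1) (U m j).
  exact: (meas_wrt_sub (FF _) (FF _) (@Finc (m + j)%N) IH).
rewrite addnS; apply: measurable_maxr; first exact: measurable_cst.
apply: measurable_funD; first exact: IH.
by apply: measurable_funB; [exact: mA|exact: mB].
Qed.

Let mUT m j : measurable_fun setT (U m j).
Proof. exact: (meas_wrt_measurable (FF _) (@mU m j)). Qed.

(** Reflection does not increase squares, and the cross term [2 * U * (A - B)] has nonpositive mean
    by [pull_out_le], as [U] is nonnegative and known at time [m + j]. So each step adds at most
    [E A^2 + E B^2 <= 2 * C]. *)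
Lemma lindley_sqr_le m j : (\int[P]_w (U m j w ^+ 2)%:E <= (2 * C * j%:R)%:E)%E.
Proof.
elim: j => [|j IH].
  rewrite mulr0 integral0_eq // => w _; by rewrite /U /= expr0n.
set i := (m + j)%N.
have mAT : measurable_fun setT (A i) by exact: (meas_wrt_measurable (FF _) (@mA i)).
have mBT : measurable_fun setT (B i) by exact: (meas_wrt_measurable (FF _) (@mB i)).
pose V w := 2 * U m j w.
have U0 w k : 0 <= U m k w by exact: lindley_ge0.
have V0 w : 0 <= V w by rewrite mulr_ge0.
have mV : meas_wrt (F i) V.
  by apply: measurable_funM; [exact: measurable_cst|exact: mU].
have mVT : measurable_fun setT V by exact: meas_wrt_measurable (FF _) mV.
have VAB := pull_out_le (mu := P) (FF i) mAT mBT (A0 i) (B0 i) (@AB i) mV V0.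
have mE (f : Omega -> R) : measurable_fun setT f ->
    measurable_fun setT (fun w => (f w)%:E) by move=> ?; exact/measurable_EFinP.
have m2 (f : Omega -> R) : measurable_fun setT f ->
    measurable_fun setT (fun w => (f w ^+ 2)%:E).
  by move=> mf; apply: mE; exact: measurable_funX.
have mM (f : Omega -> R) : measurable_fun setT f ->
    measurable_fun setT (fun w => (V w * f w)%:E).
  by move=> mf; apply: mE; exact: measurable_funM.
have s0 (f : Omega -> R) w : (0 <= (f w ^+ 2)%:E)%E by rewrite lee_fin sqr_ge0.
(* Finiteness of this integral allows adding it to both sides, which keeps every integrand
   nonnegative. *)
have VBfin : (\int[P]_w (V w * B i w)%:E < +oo)%E.
  apply: (@le_lt_trans _ _ (\int[P]_w ((U m j w ^+ 2)%:E + (B i w ^+ 2)%:E))%E).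
    apply: ge0_le_integral => //.
    - by move=> w _; rewrite lee_fin mulr_ge0.
    - exact: mM.
    - by apply: emeasurable_funD; exact: m2.
    - move=> w _; rewrite -EFinD lee_fin /V.
      by have := sqr_ge0 (U m j w - B i w); lra.
  rewrite ge0_integralD //; [|exact: m2..].
  by apply: lte_add_pinfty; [exact: le_lt_trans IH (ltry _)|
    exact: le_lt_trans (B2 i) (ltry _)].
have VB0 : (0 <= \int[P]_w (V w * B i w)%:E)%E.
  by apply: integral_ge0 => w _; rewrite lee_fin mulr_ge0.
have VBf : (\int[P]_w (V w * B i w)%:E)%E \is a fin_num by rewrite ge0_fin_numE.
rewrite -(leeD2rE _ _ VBf) -ge0_integralD //; last 3 first.
- exact: m2.
- by move=> w _; rewrite lee_fin mulr_ge0.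
- exact: mM.
apply: (@le_trans _ _ (\int[P]_w ((U m j w ^+ 2)%:E + ((V w * A i w)%:E +
    ((A i w ^+ 2)%:E + (B i w ^+ 2)%:E))))%E).
  apply: ge0_le_integral => //.
  - by move=> w _; rewrite adde_ge0 // lee_fin mulr_ge0.
  - by apply: emeasurable_funD; [exact: m2|exact: mM].
  - apply: emeasurable_funD; first exact: m2.
    by apply: emeasurable_funD; [exact: mM|apply: emeasurable_funD; exact: m2].
  - move=> w _; rewrite -!EFinD lee_fin /V /U /= -/(U m j w).
    have u0 := U0 w j; have a0 := A0 i w; have b0 := B0 i w.
    set u := U m j w in u0 *; rewrite -/i.
    have : 0 <= A i w * B i w by rewrite mulr_ge0.
    have := sqr_ge0 (u + (A i w - B i w)).
    by rewrite /Num.max; case: ifP => _; nra.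
have AB2 : measurable_fun setT (fun w => (A i w ^+ 2)%:E + (B i w ^+ 2)%:E)%E.
  by apply: emeasurable_funD; exact: m2.
rewrite ge0_integralD //; last 3 first.
- exact: m2.
- by move=> w _; rewrite adde_ge0 ?adde_ge0 // lee_fin mulr_ge0.
- by apply: emeasurable_funD => //; exact: mM.
rewrite ge0_integralD //; last 3 first.
- by move=> w _; rewrite lee_fin mulr_ge0.
- exact: mM.
- by move=> w _; rewrite adde_ge0.
rewrite ge0_integralD //; [|exact: m2..].
apply: (@le_trans _ _ ((2 * C * j%:R)%:E + (\int[P]_w (V w * B i w)%:E + (C%:E + C%:E))))%E.
  by rewrite leeD // leeD // leeD.
rewrite -(fineK VBf) -!EFinD lee_fin -[j.+1]addn1 natrD; lra.
Qed.

(* Almost sure convergence along the squares [K^2] follows from a summable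
   second moment bound; restarting the reflected walk at [K^2] controls all the
   times up to [(K + 1)^2], so no maximal inequality is needed. *)
Lemma one_sided_strong_law : {ae P, forall w, forall e, 0 < e ->
  \forall n \near \oo, \sum_(i < n) (A i w - B i w) <= e * n%:R}.
Proof.
have C0 : 0 <= C.
  rewrite -lee_fin; apply: le_trans (A2 0%N); apply: integral_ge0 => w _.
  by rewrite lee_fin sqr_ge0.
pose v k w := (k.+1%:R ^+ 4)^-1 * (U 0 (k.+1 ^ 2) w ^+ 2 +
  \sum_(j < (2 * k.+1).+1) U (k.+1 ^ 2) j w ^+ 2).
have mU2 m j : measurable_fun setT (fun w => U m j w ^+ 2).
  exact: measurable_funX.
have mS k : measurable_fun setT
    (fun w => \sum_(j < (2 * k.+1).+1) U (k.+1 ^ 2) j w ^+ 2).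
  by apply: measurable_sum => j; exact: mU2.
have mv k : measurable_fun setT (v k).
  by apply: measurable_funM; [exact: measurable_cst|exact: measurable_funD].
have s0 k w : 0 <= \sum_(j < (2 * k.+1).+1) U (k.+1 ^ 2) j w ^+ 2.
  by apply: sumr_ge0 => j _; exact: sqr_ge0.
have v0 k w : 0 <= v k w by rewrite mulr_ge0 ?invr_ge0 ?addr_ge0 ?sqr_ge0.
(* With [K = k.+1], the bracket integrates to at most [2 * C * K^2 + (2 * K + 1) * (4 * C * K)],
   which is at most [14 * C * K^2]. *)
have vI k : (\int[P]_w (v k w)%:E <= (14 * C * (k.+1%:R ^+ 2)^-1)%:E)%E.
  have k4 : 0 <= (k.+1%:R ^+ 4)^-1 :> R by rewrite invr_ge0 exprn_ge0.
  under eq_integral do rewrite EFinM.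
  rewrite ge0_integralZl_EFin //; last 2 first.
  - by move=> w _; rewrite lee_fin addr_ge0 ?sqr_ge0.
  - by apply/measurable_EFinP; exact: measurable_funD.
  have -> : 14 * C * (k.+1%:R ^+ 2)^-1 =
      (k.+1%:R ^+ 4)^-1 * (14 * C * k.+1%:R ^+ 2) :> R.
    have : k.+1%:R != 0 :> R by rewrite pnatr_eq0.
    by move: k.+1%:R => x x0; field.
  rewrite EFinM; apply: lee_wpmul2l; first by rewrite lee_fin.
  under eq_integral do rewrite EFinD.
  rewrite ge0_integralD //; last 4 first.
  - by move=> w _; rewrite lee_fin sqr_ge0.
  - exact/measurable_EFinP.
  - by move=> w _; rewrite lee_fin.
  - exact/measurable_EFinP.
  under [X in (_ + X)%E]eq_integral do rewrite -sumEFin.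
  rewrite ge0_integral_sum //; last 2 first.
  - by move=> j; exact/measurable_EFinP.
  - by move=> j w _; rewrite lee_fin sqr_ge0.
  apply: (@le_trans _ _ ((2 * C * (k.+1 ^ 2)%:R)%:E +
      \sum_(j < (2 * k.+1).+1) (2 * C * (2 * k.+1)%:R)%:E)%E).
    apply: leeD; first exact: lindley_sqr_le.
    apply: lee_sum => j _; apply: (le_trans (lindley_sqr_le _ _)).
    by rewrite lee_fin ler_wpM2l ?mulr_ge0 // ler_nat -ltnS ltn_ord.
  rewrite sumEFin -EFinD lee_fin sumr_const card_ord.
  rewrite -[_ *+ (2 * k.+1).+1]mulr_natl -[(2 * k.+1).+1%:R]natr1 natrX !natrM.
  have : 1 <= k.+1%:R :> R by rewrite ler1n.
  set x := k.+1%:R => x1; have := ler_wpM2l C0 x1; nra.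
have vL N : (\sum_(0 <= k < N) (\int[P]_w (v k w)%:E) <= (14 * C * 3)%:E)%E.
  apply: (@le_trans _ _ (\sum_(0 <= k < N) (14 * C * (k.+1%:R ^+ 2)^-1)%:E)%E).
    by apply: lee_sum => k _; exact: vI.
  rewrite sumEFin lee_fin -mulr_sumr ler_wpM2l ?mulr_ge0 //.
  by rewrite (le_trans (sum_inv_sqr _ _)) // gerBl divr_ge0.
apply: filterS (ae_cvg0_of_summable mv v0 vL) => w vw.
exact: (lindley_average vw).
Qed.

End strong_law.

(** * Averages of the martingale-difference errors *)

Section errors.
Context d (Omega : measurableType d) (R : realType) (P : probability Omega R).
Context (F : nat -> set (set Omega)).
Hypothesis FF : forall n, sub_sigma_field (F n).
Hypothesis Finc : forall n, F n `<=` F n.+1.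
Context (e g : nat -> Omega -> R).
Hypothesis me : forall i, meas_wrt (F i.+1) (e i).
Hypothesis e2 : forall i, P.-integrable [set: Omega] (fun w => (e i w ^+ 2)%:E).
Hypothesis ce : forall i, is_cond_exp P (F i) (e i) (fun=> 0).
Hypothesis ce2 : forall i, is_cond_exp P (F i) (fun w => e i w ^+ 2) (g i).

Let meT i : measurable_fun setT (e i).
Proof. exact: (meas_wrt_measurable (FF _) (@me i)). Qed.

Let FI i S S' : F i S -> F i S' -> F i (S `&` S').
Proof.
have [sF _] := FF i; rewrite -(measurable_g_measurableTypeE sF).
exact: measurableI.
Qed.

(** Localization: the conditional variances are bounded only by a random constant. This event is
    known at time [i], and for [m] large it always holds along a path with bounded variances. *)
Let stop (m : nat) i : set Omega := [set w | forall j, (j <= i)%N -> g j w <= m%:R].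

Let Fstop m i : F i (stop m i).
Proof.
have Fg j : F j [set w | g j w <= m%:R].
  have [sF _] := FF j; have [gF _ _] := ce2 j.
  have := borel_meas_wrtP (FF j) gF measurableT (measurable_itv `]-oo, m%:R]).
  by rewrite setTI measurable_g_measurableTypeE // set_itvE.
elim: i => [|i IH].
  rewrite (_ : stop m 0 = [set w | g 0%N w <= m%:R]) //.
  by apply/seteqP; split => [w /(_ 0%N)|w gw [|//]]; exact.
rewrite (_ : stop m i.+1 = stop m i `&` [set w | g i.+1 w <= m%:R]).
  by apply: FI => //; exact: Finc.
apply/seteqP; split => [w Tw|w [Tw gw] j].
  by split => [j ji|]; [apply: Tw; exact: leqW|exact: Tw].
by rewrite leq_eqVlt => /orP[/eqP ->//|]; exact: Tw.
Qed.

Let Fmeas i S : F i S -> measurable S.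
Proof. by have [_ sF] := FF i; exact: sF. Qed.

Let scaled_prob_le (m : nat) S : measurable S ->
  (m%:R%:E * P S <= m%:R%:E :> \bar R)%E.
Proof.
by move=> mS; rewrite -[leRHS]mule1 lee_wpmul2l ?lee_fin // probability_le1.
Qed.

Let stop_sqr m i S : F i S -> S `<=` stop m i ->
  (\int[P]_(w in S) (e i w ^+ 2)%:E <= m%:R%:E * P S)%E.
Proof.
move=> FS Sm; have [_ gI <-//] := ce2 i.
have mS := Fmeas FS.
rewrite -integral_cst //; apply: le_integral => //.
- exact: integrableS gI.
- apply/integrableP; split; first exact: measurable_cst.
  under eq_integral do rewrite gee0_abs ?lee_fin //.
  rewrite integral_cst // (le_lt_trans _ (ltry m%:R)) //.
  exact: scaled_prob_le.
- by move=> w Sw; rewrite lee_fin; exact: (Sm w (set_mem Sw) i (leqnn i)).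
Qed.

Let integral_indicM (S T : set Omega) (f : Omega -> R) :
  (\int[P]_(w in S) (\1_T w * f w)%:E = \int[P]_(w in S `&` T) (f w)%:E)%E.
Proof.
rewrite integral_mkcond [RHS]integral_mkcond; apply: eq_integral => w _.
rewrite !patchE in_setI indicE.
by case: (w \in S); case: (w \in T); rewrite ?mul1r ?mul0r.
Qed.

Let stop_sqr_le m i : (\int[P]_w (\1_(stop m i) w * e i w ^+ 2)%:E <= m%:R%:E)%E.
Proof.
rewrite integral_indicM setTI.
apply: le_trans (scaled_prob_le m (Fmeas (Fstop m i))).
by apply: stop_sqr; first exact: Fstop.
Qed.

(** Since [|e| <= 1 + e^2], on [stop m i] the conditional mean of [|e i|] is at most [1 + m], and
    the one-sided law compares with this constant. *)
Lemma abs_error_average : {ae P, forall w, (exists C : R, forall i, g i w <= C) ->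
  exists K : R, \forall n \near \oo, \sum_(i < n) `|e i w| <= K * n%:R}.
Proof.
have main m : {ae P, forall w, forall eps, 0 < eps -> \forall n \near \oo,
    \sum_(i < n) (\1_(stop m i) w * `|e i w| - (1 + m%:R)) <= eps * n%:R}.
  have ms i : measurable (stop m i) by exact: (Fmeas (Fstop m i)).
  have mabs i : meas_wrt (F i.+1) (fun w => `|e i w|).
    by apply: measurableT_comp; [exact: normr_measurable|exact: me].
  have mabsT i : measurable_fun setT (fun w => `|e i w|).
    exact: (meas_wrt_measurable (FF _) (@mabs i)).
  have m0 : 0 <= 1 + m%:R :> R by rewrite addr_ge0.
  have sq0 : 0 <= (1 + m%:R) ^+ 2 :> R by exact: sqr_ge0.
  apply: (one_sided_strong_law FF Finc (A := fun i w => \1_(stop m i) w * `|e i w|)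
    (B := fun _ _ => 1 + m%:R) (C := m%:R + (1 + m%:R) ^+ 2)) => //.
  - move=> i; apply: measurable_funM; last exact: mabs.
    apply: measurable_indic; have [sF _] := FF i.+1.
    by rewrite measurable_g_measurableTypeE //; exact: Finc.
  - by move=> i; exact: measurable_cst.
  - move=> i S FS; rewrite integral_indicM.
    have mS := Fmeas FS; have FST := FI FS (Fstop m i).
    have mST := Fmeas FST.
    apply: (@le_trans _ _ (\int[P]_(w in S `&` stop m i) (1%:E + (e i w ^+ 2)%:E))%E).
      apply: ge0_le_integral => //.
      + exact/measurable_EFinP/measurable_funTS.
      + apply: emeasurable_funD => //.
        by apply/measurable_EFinP/measurable_funTS; exact: measurable_funX.
      + move=> w _; rewrite -EFinD lee_fin -[_ ^+ 2]real_normK ?num_real //.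
        by have := sqr_ge0 (`|e i w| - 1); have := normr_ge0 (e i w); nra.
    rewrite ge0_integralD //; last 2 first.
    + by move=> w _; rewrite lee_fin sqr_ge0.
    + by apply/measurable_EFinP/measurable_funTS; exact: measurable_funX.
    rewrite !integral_cst //.
    apply: (@le_trans _ _ (1%:E * P (S `&` stop m i) + m%:R%:E * P (S `&` stop m i))%E).
      by rewrite leeD2l // stop_sqr // => w [].
    rewrite -ge0_muleDl ?lee_fin // -EFinD.
    apply: lee_wpmul2l; first by rewrite lee_fin.
    by apply: le_measure => //; exact: mem_set.
  - move=> i; apply: (@le_trans _ _ m%:R%:E); last by rewrite lee_fin lerDl.
    apply: le_trans (stop_sqr_le m i); rewrite le_eqVlt; apply/orP; left.
    apply/eqP/eq_integral => w _; rewrite exprMn real_normK ?num_real //.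
    by rewrite indicE; case: (_ \in _); rewrite ?expr1n ?expr0n.
  - move=> i; rewrite integral_cst //.
    apply: (@le_trans _ _ (((1 + m%:R) ^+ 2)%:E * 1)%E).
      by apply: lee_wpmul2l; [rewrite lee_fin|exact: probability_le1].
    by rewrite mule1 lee_fin lerDr.
apply: filterS (ae_foralln main) => w Hw [C gC].
set m := (Num.truncn `|C|).+1.
have gm i : g i w <= m%:R.
  by rewrite (le_trans (gC i)) // (le_trans (ler_norm C)) // ltW // truncnS_gt.
exists (2 + m%:R); apply: filterS (Hw m 1 ltr01) => n.
rewrite sumrB sumr_const card_ord -[(1 + m%:R) *+ n]mulr_natr.
have -> : \sum_(i < n) \1_(stop m i) w * `|e i w| = \sum_(i < n) `|e i w|.
  apply: eq_bigr => i _; rewrite indicE mem_set ?mul1r // => j _; exact: gm.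
lra.
Qed.

Let pos i w : R := Num.max (e i w) 0.
Let neg i w : R := Num.max (- e i w) 0.

Let mpos i : meas_wrt (F i.+1) (pos i).
Proof. by apply: measurable_maxr; [exact: me|exact: measurable_cst]. Qed.

Let mneg i : meas_wrt (F i.+1) (neg i).
Proof.
by apply: measurable_maxr; [apply: measurable_funN; exact: me|exact: measurable_cst].
Qed.

Let e_integrable i : P.-integrable setT (fun w => (e i w)%:E).
Proof.
have I : P.-integrable setT (fun w => 1%:E + (e i w ^+ 2)%:E)%E.
  by apply: integrableD => //; apply: finite_measure_integrable_cst.
apply: le_integrable I => //; first exact/measurable_EFinP.
move=> w _; rewrite -EFinD !abse_EFin lee_fin.
rewrite (ger0_norm (x := 1 + _)) ?addr_ge0 ?sqr_ge0 // ler_norml.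
by have := sqr_ge0 (e i w - 1); have := sqr_ge0 (e i w + 1); nra.
Qed.

(** The zero conditional mean, split into nonnegative parts to which the one-sided law applies.
    Finiteness of the negative part turns a zero difference into an equality. *)
Let pos_neg i S : F i S ->
  (\int[P]_(w in S) (pos i w)%:E = \int[P]_(w in S) (neg i w)%:E)%E.
Proof.
move=> FS; have [_ _ /(_ S FS)] := ce i.
rewrite integral0 integralE.
have mS := Fmeas FS.
have eS : P.-integrable S (fun w => (e i w)%:E) by exact: integrableS (e_integrable i).
have -> : (\int[P]_(w in S) ((fun w => (e i w)%:E)^\+) w =
    \int[P]_(w in S) (pos i w)%:E)%E.
  by apply: eq_integral => w _; rewrite funeposE /pos EFin_max.
have -> : (\int[P]_(w in S) ((fun w => (e i w)%:E)^\-) w =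
    \int[P]_(w in S) (neg i w)%:E)%E.
  by apply: eq_integral => w _; rewrite funenegE /neg EFin_max.
have fin : (\int[P]_(w in S) (neg i w)%:E)%E \is a fin_num.
  rewrite ge0_fin_numE; last first.
    by apply: integral_ge0 => w _; rewrite lee_fin le_max lexx orbT.
  apply: le_lt_trans (integral_funeneg_lt_pinfty mS eS).
  by rewrite le_eqVlt; apply/orP; left; apply/eqP/eq_integral => w _;
    rewrite funenegE /neg EFin_max.
move: fin; case: (\int[P]_(w in S) (neg i w)%:E)%E => // s _.
case: (\int[P]_(w in S) (pos i w)%:E)%E => // r [] /esym/eqP.
by rewrite subr_eq0 => /eqP ->.
Qed.

Context (W : nat -> Omega -> R) (K : R).
Hypothesis mW : forall i, meas_wrt (F i) (W i).
Hypothesis W0 : forall i w, 0 <= W i w.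
Hypothesis WK : forall i w, W i w <= K.

(** The truncated weight [V] is still known at time [i], so it preserves the conditional order of
    [A] and [B], while second moments are at most [K ^+ 2 * m]. *)
Let weighted_one_sided m (A B : nat -> Omega -> R) :
  (forall i, meas_wrt (F i.+1) (A i)) -> (forall i, meas_wrt (F i.+1) (B i)) ->
  (forall i w, 0 <= A i w) -> (forall i w, 0 <= B i w) ->
  (forall i w, A i w <= `|e i w|) -> (forall i w, B i w <= `|e i w|) ->
  (forall i S, F i S ->
     (\int[P]_(w in S) (A i w)%:E <= \int[P]_(w in S) (B i w)%:E)%E) ->
  {ae P, forall w, (forall i, g i w <= m%:R) -> forall eps, 0 < eps ->
     \forall n \near \oo, \sum_(i < n) W i w * (A i w - B i w) <= eps * n%:R}.
Proof.
move=> mA mB A0 B0 Ae Be AB.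
pose V i w := \1_(stop m i) w * W i w.
have mV i : meas_wrt (F i) (V i).
  apply: measurable_funM; last exact: mW.
  apply: measurable_indic.
  by have [sF _] := FF i; rewrite measurable_g_measurableTypeE.
have V0 i w : 0 <= V i w by rewrite mulr_ge0.
have mVS i : meas_wrt (F i.+1) (V i).
  exact: (meas_wrt_sub (FF _) (FF _) (@Finc i) (@mV i)).
(* The sign of [K] is only known through a value of [W], hence the dependence on a point. *)
have K0 (w : Omega) : 0 <= K by exact: (le_trans (W0 0%N w) (WK 0%N w)).
have VA2 (D : nat -> Omega -> R) i : measurable_fun setT (D i) ->
    (forall w, 0 <= D i w) -> (forall w, D i w <= `|e i w|) ->
    (\int[P]_w ((V i w * D i w) ^+ 2)%:E <= (K ^+ 2 * m%:R)%:E)%E.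
  move=> mD D0 De.
  have mVi := meas_wrt_measurable (FF i) (@mV i).
  have ms : measurable (stop m i) by exact: Fmeas (Fstop m i).
  apply: (@le_trans _ _ (\int[P]_w ((K ^+ 2)%:E * (\1_(stop m i) w * e i w ^+ 2)%:E))%E).
    apply: ge0_le_integral => //.
    - by move=> w _; rewrite lee_fin sqr_ge0.
    - by apply/measurable_EFinP; apply: measurable_funX; exact: measurable_funM.
    - apply/measurable_EFinP; apply: measurable_funM; first exact: measurable_cst.
      by apply: measurable_funM; [exact: measurable_indic|exact: measurable_funX].
    - move=> w _; rewrite -EFinM lee_fin /V indicE.
      case: (w \in _); last by rewrite !mul0r expr0n mulr0.
      rewrite !mul1r -exprMn -[leRHS]real_normK ?num_real // normrM.
      rewrite ler_sqr ?nnegrE ?mulr_ge0 //; apply: ler_pM => //.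
      by rewrite ger0_norm // (K0 w).
  rewrite ge0_integralZl_EFin ?sqr_ge0 //; last 2 first.
  - by move=> w _; rewrite lee_fin mulr_ge0 ?sqr_ge0.
  - apply/measurable_EFinP.
    by apply: measurable_funM; [exact: measurable_indic|exact: measurable_funX].
  by rewrite [leRHS]EFinM; apply: lee_wpmul2l => //; rewrite lee_fin sqr_ge0.
have mAT i : measurable_fun setT (A i).
  exact: (meas_wrt_measurable (FF _) (@mA i)).
have mBT i : measurable_fun setT (B i).
  exact: (meas_wrt_measurable (FF _) (@mB i)).
have VAB i S : F i S -> (\int[P]_(w in S) (V i w * A i w)%:E <=
    \int[P]_(w in S) (V i w * B i w)%:E)%E.
  move=> FS; have [sF _] := FF i.
  have mVS' : meas_wrt (F i) (fun w => \1_S w * V i w).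
    apply: measurable_funM; last exact: mV.
    by apply: measurable_indic; rewrite measurable_g_measurableTypeE.
  have VS0 w : 0 <= \1_S w * V i w by rewrite mulr_ge0.
  have := pull_out_le (mu := P) (FF i) (@mAT i) (@mBT i) (A0 i) (B0 i) (@AB i) mVS' VS0.
  under eq_integral do rewrite -mulrA.
  under [leRHS]eq_integral do rewrite -mulrA.
  by rewrite !integral_indicM setTI.
have := one_sided_strong_law FF Finc (A := fun i w => V i w * A i w)
  (B := fun i w => V i w * B i w) _ _ _ _ VAB
  (fun i => VA2 A i (@mAT i) (A0 i) (Ae i)) (fun i => VA2 B i (@mBT i) (B0 i) (Be i)).
move=> H; apply: filterS (H _ _ _ _).
- move=> w Hw gw eps eps0; apply: filterS (Hw eps eps0) => n.
  congr (_ <= _); apply: eq_bigr => i _.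
  have wi : stop m i w by move=> j _; exact: gw.
  by rewrite /V indicE mem_set // mul1r mulrBr.
- by move=> i; apply: measurable_funM; [exact: mVS|exact: mA].
- by move=> i; apply: measurable_funM; [exact: mVS|exact: mB].
- by move=> i w; rewrite mulr_ge0.
- by move=> i w; rewrite mulr_ge0.
Qed.

(** The one-sided law for the positive and negative parts, used in both orders, bounds the sum from
    both sides. *)
Lemma weighted_error_average : {ae P, forall w, (exists C : R, forall i, g i w <= C) ->
  forall eps, 0 < eps ->
  \forall n \near \oo, `|\sum_(i < n) e i w * W i w| <= eps * n%:R}.
Proof.
have p0 i w : 0 <= pos i w by rewrite le_max lexx orbT.
have n0 i w : 0 <= neg i w by rewrite le_max lexx orbT.
have pe i w : pos i w <= `|e i w| by rewrite ge_max normr_ge0 ler_norm.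
have ne i w : neg i w <= `|e i w| by rewrite ge_max normr_ge0 -normrN ler_norm.
have epn i w : pos i w - neg i w = e i w.
  rewrite /pos /neg /Num.max; do 2 case: ltP => ?; lra.
have le1 i S : F i S -> (\int[P]_(w in S) (pos i w)%:E <=
    \int[P]_(w in S) (neg i w)%:E)%E by move=> /pos_neg ->.
have le2 i S : F i S -> (\int[P]_(w in S) (neg i w)%:E <=
    \int[P]_(w in S) (pos i w)%:E)%E by move=> /pos_neg ->.
have h1 m := weighted_one_sided m (@mpos) (@mneg) p0 n0 pe ne
  le1.
have h2 m := weighted_one_sided m (@mneg) (@mpos) n0 p0 ne pe
  le2.
apply: filterS2 (ae_foralln h1) (ae_foralln h2) => w H1 H2 [C gC] eps eps0.
have gm i : g i w <= (Num.truncn `|C|).+1%:R.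
  by rewrite (le_trans (gC i)) // (le_trans (ler_norm C)) // ltW // truncnS_gt.
apply: filterS2 (H1 _ gm eps eps0) (H2 _ gm eps eps0) => n.
have -> : \sum_(i < n) W i w * (pos i w - neg i w) = \sum_(i < n) e i w * W i w.
  by apply: eq_bigr => i _; rewrite epn mulrC.
have -> : \sum_(i < n) W i w * (neg i w - pos i w) = - \sum_(i < n) e i w * W i w.
  by rewrite -sumrN; apply: eq_bigr => i _; rewrite -opprB epn mulrN mulrC.
by rewrite ler_norml => h3 h4; rewrite h3 andbT lerNl.
Qed.

End errors.

(** * Finite parameter nets and the basic least squares inequality *)

Section nets.
Context (R : realType) (Xs Th : pseudoMetricType R) (mu : Xs -> Th -> R).
Hypothesis cX : compact [set: Xs].
Hypothesis cT : compact [set: Th].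
Hypothesis muc : continuous (fun q : Xs * Th => mu q.1 q.2).

Lemma continuous_bounded : exists M : R, forall x th, `|mu x th| <= M.
Proof.
have cXT : compact [set: Xs * Th] by rewrite -setXTT; exact: compact_setX.
have /compact_near_coveringP := cXT.
move=> /(_ R +oo%R (fun M q => `|mu q.1 q.2| <= M) _) H.
suff /filter_ex[M MP] : \forall M \near +oo%R, [set: Xs * Th] `<=`
    (fun q => `|mu q.1 q.2| <= M).
  by exists M => x th; exact: (MP (x, th)).
apply: H => q _; have /cvgrPdist_lt /(_ 1 ltr01) near_q := @muc q.
exists ([set q' | `|mu q.1 q.2 - mu q'.1 q'.2| < 1],
        [set M | `|mu q.1 q.2| + 1 < M]).
  by split => //=; apply: nbhs_pinfty_gt; exact: num_real.
move=> [q' M] /= [h1 h2].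
rewrite (_ : mu q'.1 q'.2 = mu q.1 q.2 - (mu q.1 q.2 - mu q'.1 q'.2)); last by ring.
by rewrite (le_trans (ler_normB _ _)) //; lra.
Qed.

Lemma parameter_net (eta : R) : 0 < eta ->
  exists s : seq Th, forall th, exists2 th', th' \in s &
    forall x, `|mu x th - mu x th'| <= eta.
Proof.
move=> eta0.
have muc' : continuous (fun q : Th * Xs => mu q.2 q.1).
  move=> q; apply: (continuous_comp (f := fun q : Th * Xs => (q.2, q.1))
    (g := fun q : Xs * Th => mu q.1 q.2)); last exact: muc.
  by apply: cvg_pair; [exact: cvg_snd|exact: cvg_fst].
have modulus := @uniform_modulus _ _ _ (fun th x => mu x th) _ cT cX muc' eta0.
have [r [r0 rP]] : exists r : R, 0 < r /\ forall x th th', ball th r th' ->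
    `|mu x th' - mu x th| <= eta.
  apply: (filter_ex (F := (0 : R)^'+)); apply: filterI; last exact: modulus.
  exact: nbhs_right_gt.
(* Finite lists ordered by inclusion: a list that is good near each parameter then yields a single
   list good for all. *)
pose up : set_system (seq Th) :=
  filter_from setT (fun s : seq Th => [set t : seq Th | {subset s <= t}]).
have upF : Filter up.
  apply: filter_from_filter; first by exists [::].
  move=> s t _ _; exists (s ++ t) => // u /= stu.
  by split=> th ths; apply: stu; rewrite mem_cat ths ?orbT.
have /compact_near_coveringP := cT.
move=> /(_ _ up (fun (s : seq Th) th => exists2 th', th' \in s &
    forall x, `|mu x th - mu x th'| <= eta) upF) [th0 _|s _ sP]; last first.
  by exists s => th; exact: (sP s).
exists (ball th0 r, [set t : seq Th | {subset [:: th0] <= t}]).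
  by split; [exact: nbhsx_ballx|exists [:: th0]].
move=> [th t] /= [th0th th0t]; exists th0; first by apply: th0t; rewrite inE.
by move=> x; exact: rP.
Qed.

End nets.

(** Expanding the squares in the least squares comparison bounds the discrepancy by twice the
    error-weighted sum of [mu _ th - mu _ thbar]. Replacing [th] by the net point [th'] costs [eta]
    times the absolute errors. The shift [M] cancels; it serves to make the weights nonnegative. *)
Lemma discrepancy_le (R : realType) (Xs Th : pseudoMetricType R)
  (mu : Xs -> Th -> R) (x : nat -> Xs) (y e : nat -> R) (th th' thbar : Th)
  (M eta : R) (n : nat) :
  (forall i, (1 <= i)%N -> y i = mu (x i) thbar + e i) ->
  (forall z, `|mu z th - mu z th'| <= eta) ->
  \sum_(1 <= i < n.+1) (y i - mu (x i) th) ^+ 2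
    <= \sum_(1 <= i < n.+1) (y i - mu (x i) thbar) ^+ 2 ->
  discrepancy mu x th thbar n <=
    2 * (eta * \sum_(i < n) `|e i.+1|
         + `|\sum_(i < n) e i.+1 * (mu (x i.+1) th' + M)|
         + `|\sum_(i < n) e i.+1 * (mu (x i.+1) thbar + M)|).
Proof.
move=> ye net; rewrite /discrepancy !big_add1 !big_mkord /= => LS.
pose h i := mu (x i.+1) th - mu (x i.+1) thbar.
have : \sum_(i < n) h i ^+ 2 <= 2 * \sum_(i < n) e i.+1 * h i.
  rewrite -subr_ge0 mulr_sumr -sumrB; move: LS; rewrite -subr_ge0 -sumrB.
  congr (_ <= _); apply: eq_bigr => i _; rewrite ye // /h; ring.
move/le_trans; apply; rewrite ler_pM2l //.
have -> : \sum_(i < n) e i.+1 * h i =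
    \sum_(i < n) e i.+1 * (mu (x i.+1) th - mu (x i.+1) th')
    + \sum_(i < n) e i.+1 * (mu (x i.+1) th' + M)
    - \sum_(i < n) e i.+1 * (mu (x i.+1) thbar + M).
  by rewrite -big_split -sumrB; apply: eq_bigr => i _ /=; rewrite /h; ring.
apply: lerD; last by rewrite -normrN ler_norm.
apply: lerD; last exact: ler_norm.
rewrite mulr_sumr; apply: ler_sum => i _.
rewrite (le_trans (ler_norm _)) // normrM mulrC; apply: ler_wpM2r => //.
Qed.

(** * Strong consistency: linear lower bound against small upper bound *)

Unset Implicit Arguments.
Set Strict Implicit.

Theorem theorem3p1
  (R : realType) (Xs Th : pseudoMetricType R) (p : nat)
  (mu : Xs -> Th -> R) (f : Th -> Xs -> 'cV[R]_p)
  (d : measure_display) (Omega : measurableType d) (P : probability Omega R)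
  (thbar : Th) (nst : nat) (xst : nat -> Xs)
  (F : nat -> set (set Omega))
  (X : nat -> Omega -> Xs) (Y e : nat -> Omega -> R)
  (thhat thLS : nat -> Omega -> Th) :
  (* compact metric spaces *)
  hausdorff_space Xs -> compact [set: Xs] ->
  hausdorff_space Th -> compact [set: Th] ->
  continuous (fun q : Xs * Th => mu q.1 q.2) ->
  continuous (fun q : Xs * Th => f q.2 q.1) ->
  (forall th, spans (f th)) ->
  (* saturated identifiability *)
  (forall (z : 'I_p -> Xs), injective z ->
     forall th th', (forall j, mu (z j) th = mu (z j) th') -> th = th') ->
  (* initial design *)
  (forall i w, (1 <= i <= nst)%N -> X i w = xst i) ->
  (forall th, posdef (info_emp f xst nst th)) ->
  (* adaptive estimators: measurable functions of the data available at stage n *)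
  (forall n, (nst <= n)%N -> borel_meas_wrt measurable (thhat n)) ->
  (forall n, (nst <= n)%N -> forall w w',
     (forall i, (1 <= i <= n)%N -> X i w = X i w' /\ Y i w = Y i w') ->
     thhat n w = thhat n w') ->
  (* adaptive Wynn algorithm *)
  (forall n w, (nst <= n)%N -> forall x : Xs,
     let th := thhat n w in
     let Minv := invmx (info_emp f (fun i => X i w) n th) in
     ((f th x)^T *m Minv *m f th x) 0 0
       <= ((f th (X n.+1 w))^T *m Minv *m f th (X n.+1 w)) 0 0) ->
  (* (A1) filtration *)
  (forall n, sub_sigma_field (F n)) ->
  (forall n, F n `<=` F n.+1) ->
  (forall i, (1 <= i)%N -> borel_meas_wrt (F i.-1) (X i)) ->
  (forall i, (1 <= i)%N -> borel_meas_wrt (F i) (Y i)) ->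
  (* (A2) regression model with martingale-difference errors *)
  (forall i w, (1 <= i)%N -> Y i w = mu (X i w) thbar + e i w) ->
  (forall i, (1 <= i)%N -> measurable_fun [set: Omega] (e i)) ->
  (forall i, (1 <= i)%N ->
     P.-integrable [set: Omega] (fun w => ((e i w) ^+ 2)%:E)) ->
  (forall i, (1 <= i)%N -> is_cond_exp P (F i.-1) (e i) (fun _ => 0)) ->
  (exists g : nat -> Omega -> R,
     (forall i, (1 <= i)%N -> is_cond_exp P (F i.-1) (fun w => (e i w) ^+ 2) (g i))
     /\ {ae P, forall w, exists C : R, forall i, (1 <= i)%N -> g i w <= C}) ->
  (* least squares estimators *)
  (forall n, (nst <= n)%N -> borel_meas_wrt measurable (thLS n)) ->
  (forall n w, (nst <= n)%N -> forall th : Th,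
     \sum_(1 <= i < n.+1) (Y i w - mu (X i w) (thLS n w)) ^+ 2
       <= \sum_(1 <= i < n.+1) (Y i w - mu (X i w) th) ^+ 2) ->
  {ae P, forall w, thLS n w @[n --> \oo] --> thbar}.
Proof.
move=> hX cX hT cT muc fc fspan ident xinit pd _ _ wynn FF Finc mX mY Ye _ e2I.
move=> ce [g [ce2 gbound]] _ LS.
(* For [p = 0], identifiability for the empty family makes all parameters equal. *)
have [p0|p0] := posnP p.
  apply: aeW => w.
  have all_eq th : th = thbar.
    have z : 'I_p -> Xs by rewrite p0 => -[].
    by apply: (ident z) => [[i]|[i]]; move=> ip; exfalso; move: ip; rewrite p0.
  by rewrite (_ : (fun n => thLS n w) = fun=> thbar);
    [exact: cvg_cst|apply/funext => n].
have [r r0 rP] := wynn_visits p0 cX cT fc pd.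
have [M MP] := continuous_bounded cX cT muc.
have muT th : continuous (mu ^~ th).
  move=> x; apply: (continuous_comp (f := fun x => (x, th))
    (g := fun q : Xs * Th => mu q.1 q.2)); last exact: muc.
  by apply: cvg_pair; [exact: cvg_id|exact: cvg_cst].
have mmu i th : meas_wrt (F i) (fun w => mu (X i.+1 w) th).
  apply: borel_meas_wrtP => // U oU.
  apply: (mX i.+1 isT ((mu ^~ th) @^-1` U)).
  by apply: open_comp oU => x _; exact: muT.
have me i : meas_wrt (F i.+1) (e i.+1).
  have -> : e i.+1 = (fun w => Y i.+1 w - mu (X i.+1 w) thbar).
    by apply/funext => w; rewrite Ye // addrC addKr.
  apply: measurable_funB; first exact: borel_meas_wrtP (FF _) (mY i.+1 isT).
  exact: (meas_wrt_sub (FF _) (FF _) (Finc i) (mmu i thbar)).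
pose W th i w := mu (X i.+1 w) th + M.
have mW th i : meas_wrt (F i) (W th i).
  by apply: measurable_funD; [exact: mmu|exact: measurable_cst].
have W0 th i w : 0 <= W th i w.
  by have := MP (X i.+1 w) th; rewrite ler_norml /W => /andP[]; lra.
have WK th i w : W th i w <= 2 * M.
  by have := MP (X i.+1 w) th; rewrite ler_norml /W => /andP[]; lra.
have net k := parameter_net cX cT muc (eta := k.+1%:R^-1) ltac:(by rewrite invr_gt0).
have [s sP] := choice net.
have avg th := weighted_error_average FF Finc (e := fun i => e i.+1)
  (g := fun i => g i.+1) me (fun i => e2I i.+1 isT)
  (fun i => ce i.+1 isT) (fun i => ce2 i.+1 isT) (mW th) (W0 th) (WK th).
have abs_avg := abs_error_average FF Finc (e := fun i => e i.+1)
  (g := fun i => g i.+1) me (fun i => ce2 i.+1 isT).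
(* The net to be used depends on the path, so the averages are controlled almost surely for the
   countably many nets together; indices past the end of a list give [thbar]. *)
have avg_net := ae_foralln (fun k => ae_foralln (fun j => avg (nth thbar (s k) j))).
near=> w.
have gw : exists C : R, forall i, g i.+1 w <= C.
  have [C gC] : exists C : R, forall i, (1 <= i)%N -> g i w <= C by near: w.
  by exists C => i; exact: gC.
have [K KP] : exists K : R, \forall n \near \oo, \sum_(i < n) `|e i.+1 w| <= K * n%:R.
  by have := gw; near: w.
have bar_avg : forall eps, 0 < eps -> \forall n \near \oo,
    `|\sum_(i < n) e i.+1 w * W thbar i w| <= eps * n%:R.
  by have := gw; near: w; exact: avg.
have nets_avg : forall k j eps, 0 < eps -> \forall n \near \oo,
    `|\sum_(i < n) e i.+1 w * W (nth thbar (s k) j) i w| <= eps * n%:R.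
  by move=> k j; have := gw; move: k j; near: w; exact: avg_net.
apply/cvg_ballP => eps eps0.
have [c c0 [N NP]] := discrepancy_linear nst thbar p0 cX cT muc ident r0 eps0.
have xr : forall n, (nst <= n)%N ->
    visits (X^~ w) (ball (X n.+1 w) r) n * (p%:R - 2^-1) <= n%:R.
  by apply: (rP (X^~ w) (thhat^~ w)) => [i|n]; [exact: xinit|exact: wynn].
(* The mesh [1 / (k + 1)] is chosen so that its product with the mean absolute error is at most
   [c / 8]. *)
pose k := Num.truncn (8 * `|K| / c).
have kK : k.+1%:R^-1 * `|K| <= c / 8.
  rewrite mulrC ler_pdivrMr ?ltr0n //.
  have : 8 * `|K| / c < k.+1%:R by exact: truncnS_gt.
  by rewrite ltr_pdivrMr //; lra.
have c16 : 0 < c / 16 by rewrite divr_gt0.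
have net_avg : \forall n \near \oo, forall j : 'I_(size (s k)),
    `|\sum_(i < n) e i.+1 w * W (nth thbar (s k) j) i w| <= c / 16 * n%:R.
  by apply: filter_forall => j; exact: nets_avg.
near=> n; apply: contrapT => far.
have n0 : (0 < n)%N by near: n; exists 1%N.
have nn : (nst <= n)%N by near: n; exists nst.
have Nn : (N <= n)%N by near: n; exists N.
(* Outside the ball the discrepancy is at least [c * n], yet at most
   [2 * (c/8 + c/16 + c/16) * n = c * n / 2]. *)
have lower := NP (X^~ w) xr n _ Nn far.
have [th' th's th'P] := sP k (thLS n w).
have upper := @discrepancy_le _ _ _ mu (X^~ w) (Y^~ w) (e^~ w) _ _ thbar M _ n
  (fun i => Ye i w) th'P (LS n w nn thbar).
have h1 : \sum_(i < n) `|e i.+1 w| <= K * n%:R by near: n.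
have h2 : `|\sum_(i < n) e i.+1 w * W thbar i w| <= c / 16 * n%:R.
  by near: n; exact: bar_avg.
have h3 : `|\sum_(i < n) e i.+1 w * W th' i w| <= c / 16 * n%:R.
  have js : (index th' (s k) < size (s k))%N by rewrite index_mem.
  have h : forall j : 'I_(size (s k)),
      `|\sum_(i < n) e i.+1 w * W (nth thbar (s k) j) i w| <= c / 16 * n%:R.
    by near: n.
  by have := h (Ordinal js); rewrite /= nth_index.
have n0R : 0 < n%:R :> R by rewrite ltr0n.
have h4 : k.+1%:R^-1 * \sum_(i < n) `|e i.+1 w| <= c / 8 * n%:R.
  apply: (@le_trans _ _ (k.+1%:R^-1 * (`|K| * n%:R))).
    apply: ler_wpM2l; first by rewrite invr_ge0.
    by rewrite (le_trans h1) // ler_wpM2r ?ler_norm.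
  by rewrite mulrA; apply: ler_wpM2r.
have cn : 0 < c * n%:R by rewrite mulr_gt0.
move: (le_trans lower upper) h2 h3 h4; rewrite /W.
set a := _^-1 * _; set b := `|_|; set b' := `|_|.
rewrite ![_ / _ * n%:R]mulrAC; move: (c * n%:R) cn a b b' => q q0 a b b'; lra.
Unshelve. all: by end_near.
Qed.
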